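(* Let $X$ be a zero-mean real-valued random variable, let $U$ be uniformly distributed on $[0,1]$ and independent of $X$, and let $\mathsf{r}$ be the reciprocating function of $X$, $U_X$ the associated randomization variable and $W:=|X-\mathsf{r}(X,U_X)|$ (all defined in the context). Then: (i) There exist an event $\Omega_0\in\Sigma$ such that $\mathsf{P}(\Omega_0)=1$ and continuous functions $c\colon V_0\to(-\infty,0]$ and $d\colon V_0\to[0,\infty)$ defined on the set $V_0:=\{W(\omega)\colon\omega\in\Omega_0\}$ such that $d$ and $-c$ are nondecreasing on $V_0$, and on $\Omega_0$ one has $$\{X,\mathsf{r}(X,U_X)\}=\{c(W),d(W)\}\quad\text{and}\quad d(W)-c(W)=W.$$ (ii) With $\Omega_0,V_0,c,d$ as in (i), for every $v\in V_0$ let $D_v$ be a random variable such that, if $v\neq0$, $$D_v=\begin{cases} d(v) & \text{with probability } \frac{|c(v)|}{|c(v)|+d(v)},\\ c(v) & \text{with probability } \frac{d(v)}{|c(v)|+d(v)},\end{cases}$$ and $D_0\equiv0$; thus $D_v$ takes on at most two distinct values and $\mathsf{E}D_v=0$. Then the conditional distribution of $X$ given $W$ coincides with that of $D_W$, in the following sense: for all Borel functions $f\colon\mathbb{R}\to[0,\infty)$ and all Borel sets $B\subseteq[0,\infty)$, $$\mathsf{E}f(X)\mathbf{I}\{W\in B\}=\mathsf{E}\varphi_f(W)\mathbf{I}\{W\in B\}=\int_{\mathbb{R}}\mathsf{P}(W\in dv)\,\mathsf{E}f(D_v)\mathbf{I}\{v\in B\},$$ where $$\varphi_f(v):=\mathsf{E}f(D_v)=\begin{cases}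 f(c(v))\frac{d(v)}{|c(v)|+d(v)}+f(d(v))\frac{|c(v)|}{|c(v)|+d(v)} & \text{if } v\neq0,\\ f(0) & \text{if } v=0.\end{cases}$$ More generally, for all Borel functions $F\colon\mathbb{R}\times\mathbb{R}\to[0,\infty)$, $$\mathsf{E}F(X,W)=\int_{\mathbb{R}}\mathsf{P}(W\in dv)\,\mathsf{E}F(D_v,v);$$ in these identities one can write $\int_{[0,\infty)}$ instead of $\int_{\mathbb{R}}$.
   Context: $X$ is a zero-mean real-valued random variable (so $\mathsf{E}|X|<\infty$, $\mathsf{E}X=0$) on a probability space $(\Omega,\Sigma,\mathsf{P})$; $\mathbf{I}\{\cdot\}$ denotes the indicator. Define $$G(x):=\begin{cases}\mathsf{E}X\,\mathbf{I}\{X\in(0,x]\} & \text{if } x\in[0,\infty],\\ \mathsf{E}(-X)\,\mathbf{I}\{X\in[x,0)\} & \text{if } x\in[-\infty,0],\end{cases}$$ and $m:=G(\infty)=G(-\infty)=\frac12\mathsf{E}|X|<\infty$. For $h\in[0,m]$ let $$x_+(h):=\inf\{x\in[0,\infty]\colon G(x)\ge h\},\qquad x_-(h):=\sup\{x\in[-\infty,0]\colon G(x)\ge h\}.$$ For $x\in\mathbb{R}$ and $u\in[0,1]$ let $$H(x,u):=\begin{cases}G(x-)+u\,(G(x)-G(x-)) & \text{if } x\in[0,\infty),\\ G(x+)+u\,(G(x)-G(x+)) & \text{if } x\in(-\infty,0],\end{cases}$$ where $G(x\mp)$ are one-sided limits ($G$ is continuous at $0$ with $G(0)=0$, so the two lines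 agree at $x=0$). The reciprocating function of $X$ is $$\mathsf{r}(x,u):=\begin{cases}x_-(H(x,u)) & \text{if } x\in[0,\infty),\\ x_+(H(x,u)) & \text{if } x\in(-\infty,0].\end{cases}$$ $U\colon\Omega\to\mathbb{R}$ is uniformly distributed on $[0,1]$ and independent of $X$. For real $x$, $U_x:=U$ if $\mathsf{P}(X=x)\neq0$ and $U_x:=1$ if $\mathsf{P}(X=x)=0$; and $U_X(\omega):=U_{X(\omega)}(\omega)$. Finally $W:=|X-\mathsf{r}(X,U_X)|$. The variable $D_v$ is defined for $v\in V_0$, and $W\in V_0$ on $\Omega_0$; values of integrands outside $V_0$ play no role. *)

(* Defs.v *)
From HB Require Import structures.
From mathcomp Require Import all_boot all_order all_algebra.
From mathcomp Require Import all_classical all_reals all_analysis.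
From mathcomp Require Import measurable_realfun.

Set Implicit Arguments.
Unset Strict Implicit.
Unset Printing Implicit Defensive.
Import Order.TTheory GRing.Theory Num.Theory.
Import numFieldNormedType.Exports.
Local Open Scope classical_set_scope.
Local Open Scope ring_scope.

Section reciprocating_function.
Context {d : measure_display} {T : measurableType d} {R : realType}
  {P : probability T R}.
Variables X U : {RV P >-> R}.

(* Both expectations are finite whenever X is integrable, so that [fine] loses
   nothing; the two branches both give 0 at x = 0. *)
Definition Gfun (x : \bar R) : R :=
  if (0 <= x)%E
  then fine 'E_P[X \* \1_[set w | (0 < (X w)%:E <= x)%E]]
  else fine 'E_P[(\- X) \* \1_[set w | (x <= (X w)%:E < 0)%E]].

Definition xplus (h : R) : \bar R :=
  ereal_inf [set x | (0 <= x)%E /\ h <= Gfun x].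

Definition xminus (h : R) : \bar R :=
  ereal_sup [set x | (x <= 0)%E /\ h <= Gfun x].

Definition Gleft (x : R) : R := lim (Gfun y%:E @[y --> x^'-]).

Definition Gright (x : R) : R := lim (Gfun y%:E @[y --> x^'+]).

Definition Hfun (x u : R) : R :=
  if 0 <= x then Gleft x + u * (Gfun x%:E - Gleft x)
  else Gright x + u * (Gfun x%:E - Gright x).

(* Extended-real valued: it may be infinite, but only on a null set of the
   values of X. *)
Definition recip (x u : R) : \bar R :=
  if 0 <= x then xminus (Hfun x u) else xplus (Hfun x u).

Definition Uat (x : R) (w : T) : R := if pmf X x != 0 then U w else 1.

Definition UX (w : T) : R := Uat (X w) w.

Definition gap (w : T) : \bar R := `|(X w)%:E - recip (X w) (UX w)|%E.

Let fine_expectation_le (f g : T -> R) (K : R) :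
  measurable_fun setT f -> measurable_fun setT g ->
  (forall w, 0 <= f w <= g w) -> (forall w, g w <= K) ->
  fine 'E_P[f] <= fine 'E_P[g].
Proof.
move=> mf mg fg gK.
have f0 w : 0 <= f w by have /andP[] := fg w.
have g0 w : 0 <= g w by have /andP[h1 h2] := fg w; exact: le_trans h2.
have fleg : ('E_P[f] <= 'E_P[g])%E.
  by apply: expectation_le => //; apply/aeW => w; have /andP[] := fg w.
have gfin : ('E_P[g] < +oo)%E.
  apply: (@le_lt_trans _ _ K%:E); last exact: ltry.
  rewrite -(expectation_cst P K); apply: expectation_le => //.
    by move=> w; rewrite /cst (le_trans (g0 w)).
  exact/aeW.
have Ef0 := expectation_ge0 P f0.
have Eg0 := expectation_ge0 P g0.
apply: fine_le => //; rewrite ge0_fin_numE//.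
exact: le_lt_trans gfin.
Qed.

Let mX_oc (a b : \bar R) : measurable [set w | (a < (X w)%:E <= b)%E].
Proof.
have mX : measurable_fun setT (EFin \o X) by exact/measurable_EFinP.
have := mX measurableT _ (emeasurable_itv `]a, b]).
by rewrite setTI.
Qed.

Let mX_co (a b : \bar R) : measurable [set w | (a <= (X w)%:E < b)%E].
Proof.
have mX : measurable_fun setT (EFin \o X) by exact/measurable_EFinP.
have := mX measurableT _ (emeasurable_itv `[a, b[).
by rewrite setTI.
Qed.

Let Gfun_nd (x y : R) : 0 <= x -> x <= y -> Gfun x%:E <= Gfun y%:E.
Proof.
move=> x0 xy; have y0 := le_trans x0 xy.
rewrite /Gfun !lee_fin x0 y0; apply: (@fine_expectation_le _ _ y).
- exact: measurable_funM.
- exact: measurable_funM.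
- move=> w; rewrite /= !indicE !mem_setE !unfold_in !lte_fin !lee_fin.
  have [X0|X0] := ltP 0 (X w); last by rewrite !mulr0 lexx.
  have [Xx|Xx] := leP (X w) x; first by rewrite (le_trans Xx xy) mulr1 lexx ltW.
  by rewrite mulr0 lexx mulr_ge0// ltW.
- move=> w; rewrite /= !indicE !mem_setE !unfold_in !lte_fin !lee_fin.
  by case: andP => [[_ ?]|_]; rewrite ?mulr1 ?mulr0.
Qed.

Let Gfun_ni (x y : R) : x <= y -> y < 0 -> Gfun y%:E <= Gfun x%:E.
Proof.
move=> xy y0; have x0 := le_lt_trans xy y0.
rewrite /Gfun !lee_fin (lt_geF x0) (lt_geF y0); apply: (@fine_expectation_le _ _ (- x)).
- by apply: measurable_funM => //; exact: measurableT_comp.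
- by apply: measurable_funM => //; exact: measurableT_comp.
- move=> w; rewrite /= !indicE !mem_setE !unfold_in !lte_fin !lee_fin.
  have [X0|X0] := ltP (X w) 0; last by rewrite !andbF !mulr0 lexx.
  have NX0 : 0 <= - X w by rewrite oppr_ge0 ltW.
  have [yX|yX] := leP y (X w); first by rewrite (le_trans xy yX) mulr1 lexx NX0.
  by rewrite mulr0 lexx mulr_ge0.
- move=> w; rewrite /= !indicE !mem_setE !unfold_in !lte_fin !lee_fin.
  case: andP => [[? _]|_]; rewrite ?mulr1 ?mulr0 ?lerN2//.
  by rewrite oppr_ge0 ltW.
Qed.

Let Gfun_ge0 (x : R) : 0 <= Gfun x%:E.
Proof.
rewrite /Gfun; case: ifPn => _; apply: fine_ge0; apply: expectation_ge0 => w /=;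
  rewrite indicE mem_setE unfold_in !lte_fin !lee_fin.
- by have [X0|X0] := ltP 0 (X w); rewrite ?mulr0// mulr_ge0// ltW.
- have [X0|X0] := ltP (X w) 0; rewrite ?andbF ?mulr0// mulr_ge0//.
  by rewrite oppr_ge0 ltW.
Qed.

Let measurable_left_lim (f : R -> R) : (forall y, 0 <= f y) ->
  (forall x y, 0 < x -> x <= y -> f x <= f y) ->
  measurable_fun (`]0, +oo[ : set R) (fun x => lim (f y @[y --> x^'-])).
Proof.
move=> f0 fnd.
have cvgf x : 0 < x -> cvg (f y @[y --> x^'-]).
  move=> x0; apply: nondecreasing_at_left_is_cvgr; near=> a.
  - move=> u v; rewrite !in_itv/= => /andP[au _] _ uv; apply: fnd => //.
    by apply: lt_trans au; near: a; exact: nbhs_left_gt.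
  - exists (f x) => _ [u/=] /[!in_itv]/= /andP[au ux] <-.
    apply: fnd; last exact: ltW.
    by apply: lt_trans au; near: a; exact: nbhs_left_gt.
pose g x := if 0 < x then lim (f y @[y --> x^'-]) else 0.
apply: (eq_measurable_fun g).
  by move=> x; rewrite inE/= in_itv/= andbT /g => ->.
apply: nondecreasing_measurable => // a b ab; rewrite /g.
case: ltP => [a0|_].
  rewrite (lt_le_trans a0 ab).
  move: ab; rewrite le_eqVlt => /predU1P[->//|ab].
  have b0 := lt_trans a0 ab.
  apply: (@le_trans _ _ (f a)).
    apply: limr_le; first exact: cvgf.
    near=> y; apply: fnd; last by near: y; exact: nbhs_left_le.
    by near: y; exact: nbhs_left_gt.
  apply: limr_ge; first exact: cvgf.
  near=> y; apply: fnd => //.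
  by near: y; exact: nbhs_left_ge.
case: ltP => // b0; apply: limr_ge; first exact: cvgf.
by near=> y.
Unshelve. all: by end_near. Qed.

Let measurable_Gfun : measurable_fun setT (Gfun \o EFin).
Proof.
rewrite (_ : _ \o _ = fun x => if 0 <= x
    then (fun x => if 0 <= x then Gfun x%:E else 0) x
    else (fun x => if x < 0 then Gfun x%:E else 0) x); last first.
  by apply/funext => x /=; case: leP.
apply: measurable_fun_ifT; first exact: measurable_fun_ler.
- apply: nondecreasing_measurable => // a b ab; case: ifPn => a0.
    by rewrite (le_trans a0 ab) Gfun_nd.
  by case: ifPn.
- apply: nonincreasing_measurable => // a b ab; case: ifPn => b0.
    by rewrite (le_lt_trans ab b0) Gfun_ni.
  by case: ifPn.
Qed.

Let measurable_Gleft : measurable_fun (`]0, +oo[ : set R) Gleft.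
Proof.
by apply: measurable_left_lim => // x y /ltW; exact: Gfun_nd.
Qed.

Let measurable_Gright : measurable_fun (`]-oo, 0[ : set R) Gright.
Proof.
have := @measurable_left_lim (fun y => Gfun (- y)%:E).
move=> /(_ (fun=> Gfun_ge0 _)).
have h x y : 0 < x -> x <= y -> Gfun (- x)%:E <= Gfun (- y)%:E.
  by move=> x0 xy; apply: Gfun_ni; rewrite ?lerN2// oppr_lt0.
move=> /(_ h) mf.
rewrite (_ : Gright =
    (fun x => lim (Gfun (- y)%:E @[y --> x^'-])) \o -%R); last first.
  apply/funext => x /=; rewrite /Gright; congr lim.
  rewrite at_leftN (_ : (fun y => Gfun y%:E) = fun y => Gfun (- - y)%:E)//.
  by apply/funext => y; rewrite opprK.
apply: measurable_comp mf _ => //.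
by move=> _ [x/= /[!in_itv]/= x0 <-]; rewrite andbT oppr_gt0.
Qed.

Let measurable_Hfun (f u : T -> R) : measurable_fun setT f ->
  measurable_fun setT u -> measurable_fun setT (fun w => Hfun (f w) (u w)).
Proof.
move=> mf mu.
pose gl x := if 0 < x then Gleft x else Gleft 0.
pose gr x := if x < 0 then Gright x else 0.
have mgl : measurable_fun setT gl.
  apply: measurable_fun_if => //; first exact: measurable_fun_ltr.
  rewrite setTI (_ : _ @^-1` _ = `]0, +oo[%classic)//.
  by apply/seteqP; split=> x /=; rewrite in_itv/= andbT.
have mgr : measurable_fun setT gr.
  apply: measurable_fun_if => //; first exact: measurable_fun_ltr.
  rewrite setTI (_ : _ @^-1` _ = `]-oo, 0[%classic)//.
rewrite (_ : (fun w => _) = fun w => if 0 <= f w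
    then gl (f w) + u w * (Gfun (f w)%:E - gl (f w))
    else gr (f w) + u w * (Gfun (f w)%:E - gr (f w))); last first.
  apply/funext => w; rewrite /Hfun /gl /gr; case: ltgtP => // fw0.
  by rewrite -fw0.
have mG : measurable_fun setT (fun w => Gfun (f w)%:E).
  exact: (measurableT_comp measurable_Gfun mf).
have mglf := measurableT_comp mgl mf.
have mgrf := measurableT_comp mgr mf.
apply: measurable_fun_ifT; first exact: measurable_fun_ler.
- apply: measurable_funD => //; apply: measurable_funM => //.
  exact: measurable_funB.
- apply: measurable_funD => //; apply: measurable_funM => //.
  exact: measurable_funB.
Qed.

Let measurable_xplus : measurable_fun setT xplus.
Proof.
apply: (measurability _ (ErealGenCInfty.measurableE R)) => //.
move=> _ [_ [r ->] <-]; rewrite setTI; apply: is_interval_measurable.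
move=> s t /=; rewrite !in_itv/= !andbT => rs _ u /andP[su _].
rewrite in_itv/= andbT (le_trans rs)//; apply: ereal_inf_le_tmp => x [x0 ux].
by split=> //; exact: le_trans ux.
Qed.

Let measurable_xminus : measurable_fun setT xminus.
Proof.
apply: (measurability _ (ErealGenCInfty.measurableE R)) => //.
move=> _ [_ [r ->] <-]; rewrite setTI; apply: is_interval_measurable.
move=> s t /=; rewrite !in_itv/= !andbT => _ rt u /andP[_ ut].
rewrite in_itv/= andbT (le_trans rt)//; apply: ereal_sup_le => x [x0 ux].
by split=> //; exact: le_trans ux.
Qed.

Lemma measurable_UX : measurable_fun setT UX.
Proof.
apply: measurable_fun_ifT => //.
apply: measurable_neg; apply: measurable_fun_eqr => //.
exact: (measurableT_comp (pmf_measurable X)).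
Qed.

Lemma measurable_gap : measurable_fun setT gap.
Proof.
apply: measurableT_comp => //; apply: emeasurable_funB.
  exact/measurable_EFinP.
have mH : measurable_fun setT (fun w => Hfun (X w) (UX w)).
  by apply: measurable_Hfun => //; exact: measurable_UX.
apply: measurable_fun_ifT; first exact: measurable_fun_ler.
- exact: (measurableT_comp measurable_xminus mH).
- exact: (measurableT_comp measurable_xplus mH).
Qed.

HB.instance Definition _ := isMeasurableFun.Build _ _ _ _ gap measurable_gap.

Definition zero_mean : Prop := P.-integrable setT (EFin \o X) /\ ('E_P[X] = 0)%E.

Definition independent : Prop :=
  forall A B : set R, measurable A -> measurable B ->
    P (X @^-1` A `&` U @^-1` B) = (P (X @^-1` A) * P (U @^-1` B))%E.

Definition uniform01 : Prop :=
  forall A : set R, measurable A ->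
    distribution P U A = uniform_prob (@ltr01 R) A.

Definition gap_values (Omega0 : set T) : set R :=
  EFin @^-1` (gap @` Omega0).

(* [c] and [e] are total functions, of which only the values on
   [gap_values Omega0] matter: [{within V0, continuous c}] is continuity of the
   restriction of [c] to V0 for the subspace topology. *)
Definition gap_splitting (Omega0 : set T) (c e : R -> R) : Prop :=
  let V0 := gap_values Omega0 in
  [/\ measurable Omega0 /\ P Omega0 = 1%E,
      (forall v, V0 v -> c v <= 0) /\ (forall v, V0 v -> 0 <= e v),
      {within V0, continuous c} /\ {within V0, continuous e},
      (forall u v, V0 u -> V0 v -> u <= v -> e u <= e v) /\
      (forall u v, V0 u -> V0 v -> u <= v -> - c u <= - c v) &
      forall w, Omega0 w -> exists v : R,
        [/\ gap w = v%:E,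
            [set (X w)%:E; recip (X w) (UX w)] = [set (c v)%:E; (e v)%:E] &
            e v - c v = v]].

End reciprocating_function.

(* [l] is the integral over [D], against the law [mu] of a variable which is
   almost surely real, of a nonnegative integrand [h] which is meaningful on [V]
   only. As [V] need not be Borel, [h] is replaced by a Borel function that
   agrees with it on [V]: there is one, and the result does not depend on it. *)
Definition is_integral_from {R : realType}
    (mu : {measure set (\bar R) -> \bar R}) (V D : set R)
    (h : R -> \bar R) (l : \bar R) : Prop :=
  let extends (g : R -> \bar R) :=
    [/\ measurable_fun setT g, forall v, (0 <= g v)%E &
        forall v, V v -> g v = h v] in
  (exists g, extends g) /\
  (forall g, extends g -> (\int[mu]_(v in EFin @` D) g (fine v))%E = l).

(* Main.v *)
Require Import Defs.
From HB Require Import structures.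
From mathcomp Require Import all_boot all_order all_algebra.
From mathcomp Require Import all_classical all_reals all_analysis.
From mathcomp Require Import measurable_realfun.
From mathcomp Require Import ring lra.

Set Implicit Arguments.
Unset Strict Implicit.
Unset Printing Implicit Defensive.
Import Order.TTheory GRing.Theory Num.Theory.
Import numFieldNormedType.Exports.
Local Open Scope classical_set_scope.
Local Open Scope ring_scope.

(** Write X^+ and X^- for the positive and negative parts of X.  Weighing the
    probability by X^+ gives a measure [tilt X], A |-> E X^+ 1_A, of total mass
    m = E X^+ = E X^-, and G on the positive half-line is its distribution
    function.  As U fills the jumps of G, the rank H(X, U_X) is the
    distributional transform of X under this measure, so that it is uniformly
    distributed on [0, m] there ([tilt_rank_law]).  The same holds for - X.
    Hence the rank has one and the same law under the weights X^+ and X^-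
    ([integral_tilt_transfer]), and x_+ and x_- invert the transform: almost
    surely X is x_+(H) where it is positive and x_-(H) where it is negative,
    and its reciprocal is the other one of these two quantiles
    ([recip_quantiles]).

    This has two consequences.  The gap W is x_+(H) - x_-(H); since x_+ is
    nondecreasing and x_- nonincreasing, W orders both quantiles, so that both
    are monotone functions of W, and they are 1-Lipschitz because they differ
    by W: this is part (i) ([gap_splitting_exists]).  Moreover W is the same
    function of the rank where X > 0 and where X < 0, so that
    E X^+ psi(W) = E X^- psi(W) for every psi >= 0
    ([integral_gap_balanced]), which says that E(X | W) = 0.

    Part (ii) follows, because X takes one of the values c(W) and e(W) and a
    centred law on two given points is unique.  No conditional expectation is
    needed for this: with v = W, p = F(e(v), v) / v and q = F(c(v), v) / v, the
    variable F(X, W) and its two-point mean at W are A + p X^+ + q X^- and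
    A + q X^+ + p X^- for a common A >= 0, and the balance identity exchanges
    X^+ and X^- under the expectation ([integral_two_point_mean]). *)

(** * Size-biased measures *)

Import HBNNSimple.

Section size_biased_law.
Context {d : measure_display} {T : measurableType d} {R : realType}
  {P : probability T R}.
Variable Z : {RV P >-> R}.

(** The size-biased law of the positive part of Z, left unnormalized. *)
Definition tilt (A : set T) : \bar R :=
  (\int[P]_(w in A) (Num.max (Z w) 0)%:E)%E.

Let pos_ge0 w : (0 <= (Num.max (Z w) 0)%:E)%E.
Proof. by rewrite lee_fin le_max lexx orbT. Qed.

Lemma measurable_pos_part : measurable_fun setT (fun w => (Num.max (Z w) 0)%:E).
Proof. by apply/measurable_EFinP; exact: measurable_maxr. Qed.

Let tilt0 : tilt set0 = 0%E. Proof. exact: integral_set0. Qed.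

Let tilt_ge0 A : (0 <= tilt A)%E.
Proof. exact: integral_ge0. Qed.

Let tilt_sigma_additive : semi_sigma_additive tilt.
Proof.
by apply: semi_sigma_additive_nng_induced => //; exact: measurable_pos_part.
Qed.

HB.instance Definition _ := isMeasure.Build _ _ _ tilt
  tilt0 tilt_ge0 tilt_sigma_additive.

(** The change of density is exact on level sets of f, hence on simple
    functions, and passes to monotone limits. *)
Lemma integral_tilt (f : T -> R) : measurable_fun setT f ->
  (forall w, 0 <= f w) ->
  (\int[tilt]_w (f w)%:E = \int[P]_w (f w * Num.max (Z w) 0)%:E)%E.
Proof.
move=> mf f0.
have mF : measurable_fun setT (EFin \o f) by exact/measurable_EFinP.
have F0 w : setT w -> (0 <= (EFin \o f) w)%E by rewrite lee_fin.
pose h := nnsfun_approx measurableT mF.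
have hf w : (fun n => (h n w)%:E) @ \oo --> (f w)%:E.
  exact: (cvg_nnsfun_approx measurableT mF F0 I).
have hnd w a b : (a <= b)%N -> ((h a w)%:E <= (h b w)%:E)%E.
  by move=> ab; rewrite lee_fin; exact/lefP/nd_nnsfun_approx.
transitivity (limn (fun n => \int[tilt]_w (h n w)%:E))%E.
  rewrite -monotone_convergence//=.
  - by apply: eq_integral => w _; apply/esym/cvg_lim => //; exact: hf.
  - by move=> n; exact/measurable_EFinP.
  - by move=> n w _; rewrite lee_fin.
  - by move=> w _ a b; exact: hnd.
transitivity (limn (fun n => \int[P]_w ((h n w)%:E * (Num.max (Z w) 0)%:E)))%E;
    last first.
  rewrite -monotone_convergence//=.
  - apply: eq_integral => w _; rewrite EFinM.
    by apply/cvg_lim => //; apply: cvgeZr => //; exact: hf.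
  - move=> n; apply: emeasurable_funM; first exact/measurable_EFinP.
    exact: measurable_pos_part.
  - by move=> n w _; rewrite mule_ge0// lee_fin.
  - by move=> w _ a b ab; rewrite lee_wpmul2r//; exact: hnd.
congr (limn _); apply/funext => n.
have hE w : (h n w)%:E =
    (\sum_(y \in range (h n)) (y * \1_(h n @^-1` [set y]) w)%:E)%E.
  by rewrite {1}(fimfunE (h n)) -fsumEFin.
have ind0 w y : (0 <= (y * \1_(h n @^-1` [set y]) w)%:E)%E.
  exact: nnfun_muleindic_ge0.
under eq_integral do rewrite hE.
under [RHS]eq_integral do rewrite hE ge0_mule_fsuml//.
rewrite ge0_integral_fsum//; last first.
  by move=> y; apply/measurable_EFinP; exact: measurable_funM.
rewrite ge0_integral_fsum//; last 2 first.
- move=> y; apply: emeasurable_funM; last exact: measurable_pos_part.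
  by apply/measurable_EFinP; exact: measurable_funM.
- by move=> y w _; rewrite mule_ge0.
apply: eq_fsbigr => y /set_mem[w _ <-].
have y0 : 0 <= h n w by [].
under eq_integral do rewrite EFinM.
rewrite ge0_integralZl_EFin//; last exact/measurable_EFinP.
rewrite integral_indic// setIT.
under [RHS]eq_integral do rewrite EFinM -muleA.
rewrite ge0_integralZl_EFin//; last 2 first.
- by move=> x _; rewrite mule_ge0// lee_fin.
- apply: emeasurable_funM; last exact: measurable_pos_part.
  exact/measurable_EFinP.
congr (_ * _)%E; rewrite -[LHS]/(tilt _) /tilt [LHS]integral_mkcond.
apply: eq_integral => x _.
by rewrite patchE indicE; case: ifP => _; rewrite ?mul1e ?mul0e.
Qed.

Lemma tilt_level (x : R) (A : set T) : measurable A ->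
  A `<=` [set w | Z w = x] -> tilt A = ((Num.max x 0)%:E * P A)%E.
Proof.
move=> mA Ax; rewrite /tilt (eq_integral (fun=> (Num.max x 0)%:E)).
  by rewrite integral_cst.
by move=> w /set_mem /Ax /= ->.
Qed.

(** The density is positive on Z > 0, so that nullity passes back to P. *)
Lemma tilt_null (A : set T) : measurable A -> tilt A = 0%E ->
  P.-negligible (A `&` [set w | 0 < Z w]).
Proof.
move=> mA A0.
have mp := measurable_funTS measurable_pos_part.
have /(ae_eq_integral_abs P mA (mp A)) : (\int[P]_(w in A)
    `|(Num.max (Z w) 0)%:E| = 0)%E.
  by rewrite -[RHS]A0; apply: eq_integral => w _; rewrite gee0_abs.
apply: negligibleS => w /= [Aw Zw] /(_ Aw) /= [].
by rewrite max_l ?ltW// => Zw0; rewrite Zw0 ltxx in Zw.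
Qed.

Lemma measurable_le_level (x : R) : measurable [set w | Z w <= x].
Proof.
rewrite -[X in measurable X]setTI -[X in _ `&` X]/(Z @^-1` [set y | y <= x]).
by rewrite -set_itvNyc; apply: measurable_funP.
Qed.

Lemma measurable_lt_level (x : R) : measurable [set w | Z w < x].
Proof.
rewrite -[X in measurable X]setTI -[X in _ `&` X]/(Z @^-1` [set y | y < x]).
by rewrite -set_itvNyo; apply: measurable_funP.
Qed.

Lemma measurable_eq_level (x : R) : measurable [set w | Z w = x].
Proof.
rewrite -[X in measurable X]setTI -[X in _ `&` X]/(Z @^-1` [set x]).
by apply: measurable_funP.
Qed.

Hypothesis intZ : P.-integrable setT (EFin \o Z).

Lemma tilt_fin_num (A : set T) : measurable A -> tilt A \is a fin_num.
Proof.
move=> mA; rewrite ge0_fin_numE//.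
apply: le_lt_trans (integrableP _ _ _ intZ).2.
apply: (@le_trans _ _ (\int[P]_(w in A) `|(EFin \o Z) w|)%E).
  apply: ge0_le_integral => //.
  - exact: measurable_funTS measurable_pos_part.
  - exact/measurable_funTS/measurableT_comp/measurable_EFinP.
  - by move=> w _; rewrite lee_fin ge_max normr_ge0 ler_norm.
apply: ge0_subset_integral => //.
exact/measurableT_comp/measurable_EFinP.
Qed.

End size_biased_law.

(** * The distribution function of the size-biased measure *)

Section tilted_cdf.
Context {d : measure_display} {T : measurableType d} {R : realType}
  {P : probability T R}.
Variable Z : {RV P >-> R}.
Hypothesis intZ : P.-integrable setT (EFin \o Z).

(** G on the nonnegative half-line, and 0 on the other one, so that the
    function is monotone on the whole line; [tilt_cdfl] is its left limit. *)
Definition tilt_cdf (x : R) : R := fine (tilt Z [set w | Z w <= x]).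
Definition tilt_cdfl (x : R) : R := fine (tilt Z [set w | Z w < x]).
Definition tilt_mass : R := fine (tilt Z setT).

Lemma tilt_cdfE x : tilt Z [set w | Z w <= x] = (tilt_cdf x)%:E.
Proof. by rewrite fineK// tilt_fin_num//; exact: measurable_le_level. Qed.

Lemma tilt_cdflE x : tilt Z [set w | Z w < x] = (tilt_cdfl x)%:E.
Proof. by rewrite fineK// tilt_fin_num//; exact: measurable_lt_level. Qed.

Lemma tilt_massE : tilt Z setT = tilt_mass%:E.
Proof. by rewrite fineK// tilt_fin_num. Qed.

Lemma tilt_cdf_nd : {homo tilt_cdf : x y / x <= y}.
Proof.
move=> x y xy; rewrite -lee_fin -!tilt_cdfE; apply: le_measure.
- by rewrite inE; exact: measurable_le_level.
- by rewrite inE; exact: measurable_le_level.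
- by move=> w /= Zx; exact: le_trans xy.
Qed.

Lemma tilt_cdfl_nd : {homo tilt_cdfl : x y / x <= y}.
Proof.
move=> x y xy; rewrite -lee_fin -!tilt_cdflE; apply: le_measure.
- by rewrite inE; exact: measurable_lt_level.
- by rewrite inE; exact: measurable_lt_level.
- by move=> w /= Zx; exact: lt_le_trans xy.
Qed.

Lemma tilt_cdfl_le x : tilt_cdfl x <= tilt_cdf x.
Proof.
rewrite -lee_fin -tilt_cdfE -tilt_cdflE; apply: le_measure.
- by rewrite inE; exact: measurable_lt_level.
- by rewrite inE; exact: measurable_le_level.
- by move=> w /= /ltW.
Qed.

Lemma tilt_cdf_le_left x y : x < y -> tilt_cdf x <= tilt_cdfl y.
Proof.
move=> xy; rewrite -lee_fin -tilt_cdfE -tilt_cdflE; apply: le_measure.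
- by rewrite inE; exact: measurable_le_level.
- by rewrite inE; exact: measurable_lt_level.
- by move=> w /= Zx; exact: le_lt_trans xy.
Qed.

Lemma tilt_cdf_le_mass x : tilt_cdf x <= tilt_mass.
Proof.
rewrite -lee_fin -tilt_cdfE -tilt_massE; apply: le_measure => //.
- by rewrite inE; exact: measurable_le_level.
- by rewrite inE.
Qed.

Lemma tilt_cdf_ge0 x : 0 <= tilt_cdf x.
Proof. exact: fine_ge0. Qed.

Lemma tilt_cdfl_ge0 x : 0 <= tilt_cdfl x.
Proof. exact: fine_ge0. Qed.

Lemma tilt_cdf_le0 x : x <= 0 -> tilt_cdf x = 0.
Proof.
move=> x0; rewrite /tilt_cdf /tilt integral0_eq// => w /= Zx.
by rewrite max_r// (le_trans Zx).
Qed.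

Lemma tilt_cdf_jump x : 0 <= x -> tilt_cdf x - tilt_cdfl x = x * pmf Z x.
Proof.
move=> x0; apply/eqP; rewrite subr_eq addrC; apply/eqP/EFin_inj.
rewrite EFinD EFinM -tilt_cdfE -tilt_cdflE /pmf fineK; last first.
  by apply: fin_num_measure; exact: measurable_eq_level.
rewrite (_ : [set w | Z w <= x] = [set w | Z w < x] `|` [set w | Z w = x]).
  rewrite measureU; [|exact: measurable_lt_level|exact: measurable_eq_level|].
    congr (_ + _)%E; rewrite -[LHS]/(tilt Z _) (tilt_level (x := x))//.
      by rewrite max_l.
    exact: measurable_eq_level.
  by apply/seteqP; split=> w //= [] /[swap] ->; rewrite ltxx.
apply/seteqP; split=> w /=; first by rewrite le_eqVlt => /predU1P[]; [right|left].
by case=> [/ltW|->].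
Qed.

(** This and the next two lemmas are the continuity of the measure along
    monotone sequences of half-lines, in the order form in which quantiles use
    it. *)
Lemma tilt_cdfl_le_sup (x t : R) :
  (forall y, y < x -> tilt_cdf y <= t) -> tilt_cdfl x <= t.
Proof.
move=> Kt; pose F n := [set w | Z w <= x - n.+1%:R^-1].
have mF n : measurable (F n) by exact: measurable_le_level.
have F_lt : \bigcup_n F n = [set w | Z w < x].
  apply/seteqP; split=> w /=.
    by move=> [n _ /= /le_lt_trans]; apply; rewrite ltrBlDr ltrDl invr_gt0.
  rewrite -subr_gt0 => /ltr_add_invr[n] /[!add0r] nZ; exists n => //=.
  by rewrite /F/= lerBrDr -lerBrDl ltW.
have ndF : nondecreasing_seq F.
  move=> a b ab; apply/subsetPset => w /= /le_trans; apply.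
  by rewrite lerB// lef_pV2 ?posrE// ler_nat.
have := @nondecreasing_cvg_mu _ _ _ (tilt Z) F mF.
rewrite F_lt => /(_ (measurable_lt_level Z x) ndF) cF.
rewrite -lee_fin -tilt_cdflE -(cvg_lim _ cF)//; apply: lime_le.
  by apply/cvg_ex; eexists; exact: cF.
apply: nearW => n /=; rewrite /F tilt_cdfE lee_fin; apply: Kt.
by rewrite ltrBlDr ltrDl invr_gt0.
Qed.

Lemma tilt_cdf_ge_inf (x t : R) :
  (forall y, x < y -> t <= tilt_cdf y) -> t <= tilt_cdf x.
Proof.
move=> Kt; pose F n := [set w | Z w <= x + n.+1%:R^-1].
have mF n : measurable (F n) by exact: measurable_le_level.
have F_le : \bigcap_n F n = [set w | Z w <= x].
  apply/seteqP; split=> w /=; last first.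
    by move=> Zx n _ /=; rewrite /F/= (le_trans Zx)// lerDl invr_ge0.
  move=> FZ; rewrite leNgt; apply/negP => /ltr_add_invr[n].
  by rewrite ltNge (FZ n I).
have niF : nonincreasing_seq F.
  move=> a b ab; apply/subsetPset => w /= /le_trans; apply.
  by rewrite lerD2l lef_pV2 ?posrE// ler_nat.
have F0 : (tilt Z (F 0%N) < +oo)%E by rewrite /F tilt_cdfE ltry.
have := @nonincreasing_cvg_mu _ _ _ (tilt Z) F F0 mF.
rewrite F_le => /(_ (measurable_le_level Z x) niF) cF.
rewrite -lee_fin -tilt_cdfE -(cvg_lim _ cF)//; apply: lime_ge.
  by apply/cvg_ex; eexists; exact: cF.
apply: nearW => n /=; rewrite /F tilt_cdfE lee_fin; apply: Kt.
by rewrite ltrDl invr_gt0.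
Qed.

Lemma tilt_mass_le_sup (t : R) : (forall y, tilt_cdf y <= t) -> tilt_mass <= t.
Proof.
move=> Kt; pose F n := [set w | Z w <= n%:R].
have mF n : measurable (F n) by exact: measurable_le_level.
have F_T : \bigcup_n F n = setT.
  apply/seteqP; split=> w //= _; exists (Num.truncn (Num.max (Z w) 0)).+1 => //=.
  rewrite /F/= (@le_trans _ _ (Num.max (Z w) 0)) ?le_max ?lexx//.
  by apply/ltW/truncnS_gt.
have ndF : nondecreasing_seq F.
  by move=> a b ab; apply/subsetPset => w /= /le_trans; apply; rewrite ler_nat.
have := @nondecreasing_cvg_mu _ _ _ (tilt Z) F mF.
rewrite F_T => /(_ measurableT ndF) cF.
rewrite -lee_fin -tilt_massE -(cvg_lim _ cF)//; apply: lime_le.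
  by apply/cvg_ex; eexists; exact: cF.
by apply: nearW => n /=; rewrite /F tilt_cdfE lee_fin; exact: Kt.
Qed.

End tilted_cdf.

(** * The randomized rank is uniform under the size-biased measure *)

Section tilted_rank.
Context {d : measure_display} {T : measurableType d} {R : realType}
  {P : probability T R}.
Variables (Z : {RV P >-> R}) (V : T -> R).
Hypothesis intZ : P.-integrable setT (EFin \o Z).
Hypothesis mV : measurable_fun setT V.
Hypothesis V01 : forall w, 0 <= V w <= 1.
(* The rank depends on V only at the atoms of Z. *)
Hypothesis V_atom : forall x s, pmf Z x != 0 -> 0 <= s <= 1 ->
  P ([set w | Z w = x] `&` [set w | V w < s]) = (pmf Z x * s)%:E.

(** H(Z, V) where Z > 0, and 0 elsewhere. *)
Definition tilt_rank (w : T) : R :=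
  tilt_cdfl Z (Z w) + V w * (tilt_cdf Z (Z w) - tilt_cdfl Z (Z w)).

Lemma measurable_tilt_rank : measurable_fun setT tilt_rank.
Proof.
have mK : measurable_fun setT (tilt_cdf Z \o Z).
  apply: (measurableT_comp (f := tilt_cdf Z)) => //.
  by apply: nondecreasing_measurable => // x y; exact: tilt_cdf_nd.
have mKl : measurable_fun setT (tilt_cdfl Z \o Z).
  apply: (measurableT_comp (f := tilt_cdfl Z)) => //.
  by apply: nondecreasing_measurable => // x y; exact: tilt_cdfl_nd.
apply: measurable_funD => //; apply: measurable_funM => //.
exact: measurable_funB.
Qed.

Lemma tilt_rank_ge w : tilt_cdfl Z (Z w) <= tilt_rank w.
Proof.
have /andP[V0 _] := V01 w.
by rewrite lerDl mulr_ge0// subr_ge0 tilt_cdfl_le.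
Qed.

Lemma tilt_rank_le w : tilt_rank w <= tilt_cdf Z (Z w).
Proof.
have /andP[_ V1] := V01 w.
by rewrite -lerBrDl ler_piMl// subr_ge0 tilt_cdfl_le.
Qed.

Let measurable_rank_lt t : measurable [set w | tilt_rank w < t].
Proof.
rewrite -[X in measurable X]setTI -[X in _ `&` X]/(tilt_rank @^-1` [set y | y < t]).
by rewrite -set_itvNyo; apply: measurable_tilt_rank.
Qed.

(** Let x0 be the quantile at level t.  The event that the rank is below t
    consists of Z < x0 and of the part of Z = x0 on which V is below the
    proportion s of the jump at x0 that lies under t; by [V_atom] this part has
    the mass that is missing to t. *)
Lemma tilt_rank_law t : tilt Z [set w | tilt_rank w < t] =
  (Num.min (Num.max t 0) (tilt_mass Z))%:E.
Proof.
have m0 : 0 <= tilt_mass Z by exact: fine_ge0.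
have [t0|t0] := leP t 0.
  rewrite min_l// (_ : [set w | _] = set0) ?measure0//.
  apply/seteqP; split=> w //=; apply/negP; rewrite -leNgt (le_trans t0)//.
  exact: le_trans (tilt_cdfl_ge0 _ _) (tilt_rank_ge w).
have [Kt|] := pselect (forall y, tilt_cdf Z y < t).
  rewrite min_r; last by apply: tilt_mass_le_sup => // y; exact: ltW.
  rewrite -tilt_massE// (_ : [set w | _] = setT)//.
  by apply/seteqP; split=> w //= _; exact: le_lt_trans (tilt_rank_le w) (Kt _).
move=> /existsNP[y1 /negP]; rewrite -leNgt => ty1.
pose S := [set y | t <= tilt_cdf Z y]; pose x0 := inf S.
have lbS : lbound S 0.
  move=> y /= ty; rewrite leNgt; apply/negP => /ltW y0.
  by move: ty; rewrite /S/= leNgt tilt_cdf_le0 ?t0.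
have iS : has_inf S by split; [exists y1|exists 0].
have tx0 : t <= tilt_cdf Z x0.
  apply: tilt_cdf_ge_inf => // y; rewrite -subr_gt0 => /inf_adherent.
  move=> /(_ _ iS)[x Sx]; rewrite addrC subrK => /ltW/(tilt_cdf_nd intZ).
  exact: le_trans.
have ltx0 y : y < x0 -> tilt_cdf Z y < t.
  move=> yx0; rewrite ltNge; apply/negP => ty.
  by move: yx0; rewrite ltNge ge_inf//; exists 0.
have x0t : tilt_cdfl Z x0 <= t by apply: tilt_cdfl_le_sup => // y /ltx0/ltW.
have x0_ge0 : 0 <= x0 by apply: lb_le_inf => //; exists y1.
rewrite (_ : Num.min _ _ = t); last first.
  by rewrite min_l// (le_trans ty1)// tilt_cdf_le_mass.
pose E := [set w | Z w = x0] `&` [set w | tilt_rank w < t].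
have mE : measurable E by apply: measurableI => //; exact: measurable_eq_level.
rewrite (_ : [set w | _] = [set w | Z w < x0] `|` E); last first.
  apply/seteqP; split=> w /=.
    have [Zx|Zx|Zx] := ltgtP (Z w) x0; [by left| |by right].
    rewrite ltNge (le_trans tx0)// (le_trans _ (tilt_rank_ge w))//.
    exact: tilt_cdf_le_left.
  by case=> [Zx|[]//]; exact: le_lt_trans (tilt_rank_le w) (ltx0 _ Zx).
rewrite measureU//; last 2 first.
- exact: measurable_lt_level.
- apply/seteqP; split=> w //= -[Zx [/= Zx0 _]].
  by rewrite Zx0 ltxx in Zx.
rewrite -[X in (_ + X)%E]/(tilt Z E) -[X in (X + _)%E]/(tilt Z _) tilt_cdflE//.
have jump := tilt_cdf_jump intZ x0_ge0.
rewrite (tilt_level mE (x := x0)); last by move=> w [].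
rewrite max_l//.
have [pmf0|pmf_neq0] := eqVneq (pmf Z x0) 0.
  rewrite (_ : P E = 0%E).
    rewrite mule0 adde0; congr EFin; apply/eqP; rewrite eq_le x0t/=.
    by move: jump; rewrite pmf0 mulr0 => /subr0_eq <-.
  apply/eqP; rewrite -measure_le0.
  suff <- : P [set w | Z w = x0] = 0%E.
    apply: le_measure; rewrite ?inE//; first exact: measurable_eq_level.
    by move=> w [].
  have := pmf0; rewrite /pmf => pmf0'.
  rewrite -[LHS]fineK; last first.
    by apply: fin_num_measure; exact: measurable_eq_level.
  by rewrite pmf0'.
have [jump0|jump_neq0] := eqVneq (tilt_cdf Z x0 - tilt_cdfl Z x0) 0.
  (* an atom at the origin carries no tilted mass *)
  move: jump; rewrite jump0 => /esym/eqP; rewrite mulf_eq0 (negbTE pmf_neq0) orbF.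
  move=> /eqP x0_0; rewrite (_ : (x0%:E * P E = 0)%E); last by rewrite x0_0 mul0e.
  rewrite adde0; congr EFin; apply/eqP.
  by rewrite eq_le x0t/= -(subr0_eq jump0).
have jump_gt0 : 0 < tilt_cdf Z x0 - tilt_cdfl Z x0.
  by rewrite lt_def jump_neq0 subr_ge0 tilt_cdfl_le.
pose s := (t - tilt_cdfl Z x0) / (tilt_cdf Z x0 - tilt_cdfl Z x0).
have -> : E = [set w | Z w = x0] `&` [set w | V w < s].
  rewrite /E; apply/seteqP.
  split=> w [/= Zx]; rewrite /tilt_rank /= Zx => Vs; split=> //=.
    by rewrite ltr_pdivlMr// ltrBrDl.
  by rewrite -ltrBrDl -ltr_pdivlMr.
rewrite V_atom//; last first.
  by rewrite ler_pdivrMr// mul1r lerD2r tx0 andbT divr_ge0 ?subr_ge0// tilt_cdfl_le.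
by rewrite -EFinM -EFinD mulrA -jump /s mulrCA divff// mulr1 addrC subrK.
Qed.

(** The distribution function found in [tilt_rank_law] is 1-Lipschitz. *)
Lemma tilt_rank_atomless t : tilt Z [set w | tilt_rank w = t] = 0%E.
Proof.
have mt : measurable [set w | tilt_rank w = t].
  rewrite -[X in measurable X]setTI -[X in _ `&` X]/(tilt_rank @^-1` [set t]).
  exact: measurable_tilt_rank.
apply/eqP; rewrite -measure_le0; apply/lee_addgt0Pr => e e0; rewrite add0e.
have h : (tilt Z [set w | (tilt_rank w < t)%R] +
    tilt Z [set w | tilt_rank w = t] <=
    tilt Z [set w | (tilt_rank w < t + e)%R])%E.
  rewrite -measureU//; last first.
    by apply/seteqP; split=> w //= [] /[swap] ->; rewrite ltxx.
  apply: le_measure; rewrite ?inE//; first exact: measurableU.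
  by move=> w [/= /lt_le_trans|/= ->]; [apply|]; rewrite ?ltrDl// lerDl ltW.
rewrite -[X in (X <= _)%E]/(tilt Z _).
move: h; rewrite !tilt_rank_law -(fineK (tilt_fin_num intZ mt)) -EFinD !lee_fin.
have : Num.min (Num.max (t + e) 0) (tilt_mass Z) <=
    Num.min (Num.max t 0) (tilt_mass Z) + e.
  rewrite addr_minl addr_maxl le_min add0r !ge_min ge_max !le_max lexx (ltW e0).
  by rewrite orbT/= lerDl (ltW e0) orbT.
lra.
Qed.

(** Suppose that the rank is at most K(y) for some y < Z, with K the
    distribution function.  Then K equals the rank at every rational between y
    and Z, so that the rank has one of countably many given values, and these
    have mass 0. *)
Lemma tilt_rank_gt :
  {ae P, forall w, 0 < Z w -> forall y, y < Z w -> tilt_cdf Z y < tilt_rank w}.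
Proof.
pose N q := [set w | tilt_rank w = tilt_cdf Z (ratr q)] `&` [set w | 0 < Z w].
have N_null q : P.-negligible (N q).
  apply: tilt_null (tilt_rank_atomless _).
  rewrite -[X in measurable X]setTI.
  rewrite -[X in _ `&` X]/(tilt_rank @^-1` [set tilt_cdf Z (ratr q)]).
  exact: measurable_tilt_rank.
have : P.-negligible (\bigcup_n (if unpickle n is Some q then N q else set0)).
  apply: negligible_bigcup => n; case: unpickle => [q|]; first exact: N_null.
  exact: negligible_set0.
apply: negligibleS => w /= /not_implyP[Zw /existsNP[y /not_implyP[yZ /negP]]].
rewrite -leNgt => Hy; have [q] := rat_in_itvoo yZ; rewrite in_itv/= => /andP[yq qZ].
exists (pickle q); [exact: I|rewrite pickleK; split; [|exact: Zw]].
apply/eqP => /=.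
rewrite eq_le (le_trans Hy) ?tilt_cdf_nd// ?(ltW yq)//=.
by rewrite (le_trans _ (tilt_rank_ge w))// tilt_cdf_le_left.
Qed.

End tilted_rank.

(** * Two weights under which the ranks have one law *)

Section tilted_rank_transfer.
Context {d : measure_display} {T : measurableType d} {R : realType}
  {P : probability T R}.
Variables (Z1 Z2 : {RV P >-> R}) (H1 H2 : T -> R).
Hypotheses (intZ1 : P.-integrable setT (EFin \o Z1)).
Hypotheses (mH1 : measurable_fun setT H1) (mH2 : measurable_fun setT H2).
Hypothesis H12 : forall t,
  tilt Z1 [set w | H1 w < t] = tilt Z2 [set w | H2 w < t].

Let H1_rv : {mfun T >-> R} := HB.pack H1 (isMeasurableFun.Build _ _ _ _ _ mH1).
Let H2_rv : {mfun T >-> R} := HB.pack H2 (isMeasurableFun.Build _ _ _ _ _ mH2).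

(** The laws of H1 and H2 are finite measures that agree on the half-lines,
    hence are equal. *)
Lemma integral_tilt_transfer (phi : R -> R) : measurable_fun setT phi ->
  (forall h, 0 <= phi h) ->
  (\int[P]_w (phi (H1 w) * Num.max (Z1 w) 0)%:E =
   \int[P]_w (phi (H2 w) * Num.max (Z2 w) 0)%:E)%E.
Proof.
move=> mphi phi0.
have m1 := measurableT_comp mphi mH1.
have m2 := measurableT_comp mphi mH2.
rewrite -(integral_tilt Z1 m1) => [|w]; last exact: phi0.
rewrite -(integral_tilt Z2 m2) => [|w]; last exact: phi0.
pose f h := (phi h)%:E.
have mf : measurable_fun setT f by exact/measurable_EFinP.
have f0 : {in setT, forall h, (0 <= f h)%E} by move=> h _; rewrite lee_fin.
have := ge0_integral_pushforward mH1 (tilt Z1) measurableT mf f0.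
have := ge0_integral_pushforward mH2 (tilt Z2) measurableT mf f0.
rewrite !preimage_setT /f/= => <- <-.
apply: (@eq_measure_integral _ _ _ _ (pushforward (tilt Z2) H2_rv)
  (pushforward (tilt Z1) H1_rv)).
move=> A mA _.
apply: (measure_unique (@RGenInftyO.G R) (fun k => `]-oo, k%:R[%classic)) => //.
- exact: RGenInftyO.measurableE.
- move=> _ _ [x ->] [y ->]; exists (Num.min x y).
  by apply/seteqP; split=> z /=; rewrite !in_itv/= lt_min => /andP.
- by move=> k; exists k%:R.
- apply/seteqP; split=> // x _; exists (Num.truncn (Num.max x 0)).+1 => //=.
  rewrite in_itv/= (@le_lt_trans _ _ (Num.max x 0)) ?le_max ?lexx//.
  exact: truncnS_gt.
- move=> _ [t ->]; rewrite /pushforward set_itvNyo; exact: H12.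
- move=> k; rewrite /pushforward -ge0_fin_numE//; apply: tilt_fin_num => //.
  rewrite -[X in measurable X]setTI.
  by apply: (measurable_funP H1_rv) => //; exact: measurable_itv.
Qed.

End tilted_rank_transfer.

(** * Quantile functions of the two tails *)

Section one_sided_limits.
Context {d : measure_display} {T : measurableType d} {R : realType}
  {P : probability T R}.
Variable Z : {RV P >-> R}.
Hypothesis intZ : P.-integrable setT (EFin \o Z).

Lemma cvg_tilt_cdf_left (x : R) :
  tilt_cdf Z y @[y --> x^'-] --> tilt_cdfl Z x.
Proof.
apply/cvgrPdist_lt => e e0.
have [y yx Ky] : exists2 y, y < x & tilt_cdfl Z x - e < tilt_cdf Z y.
  apply/not_exists2P => Kx.
  have : tilt_cdfl Z x <= tilt_cdfl Z x - e.
    apply: tilt_cdfl_le_sup => // y yx; rewrite leNgt; apply/negP => Ky.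
    by have [] := Kx y.
  by rewrite leNgt ltrBlDr ltrDl e0.
near=> z.
have zx : z < x by near: z; exact: nbhs_left_lt.
have yz : y <= z by near: z; exact: nbhs_left_ge.
rewrite ger0_norm; last by rewrite subr_ge0 tilt_cdf_le_left.
by rewrite ltrBlDr -ltrBlDl (lt_le_trans Ky)// tilt_cdf_nd.
Unshelve. all: by end_near. Qed.

Lemma cvg_tilt_cdf_right (x : R) :
  tilt_cdf Z y @[y --> x^'+] --> tilt_cdf Z x.
Proof.
apply/cvgrPdist_lt => e e0.
have [y yx Ky] : exists2 y, x < y & tilt_cdf Z y < tilt_cdf Z x + e.
  apply/not_exists2P => Kx.
  have : tilt_cdf Z x + e <= tilt_cdf Z x.
    apply: tilt_cdf_ge_inf => // y yx; rewrite leNgt; apply/negP => Ky.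
    by have [] := Kx y.
  by rewrite leNgt ltrDl e0.
near=> z.
have xz : x <= z by near: z; exact: nbhs_right_ge.
have zy : z <= y by near: z; exact: nbhs_right_le.
rewrite distrC ger0_norm; last by rewrite subr_ge0 tilt_cdf_nd.
by rewrite ltrBlDl (le_lt_trans _ Ky)// tilt_cdf_nd.
Unshelve. all: by end_near. Qed.

End one_sided_limits.

Section reciprocation.
Context {d : measure_display} {T : measurableType d} {R : realType}
  {P : probability T R}.
Variables X Y : {RV P >-> R}.
Hypothesis intX : P.-integrable setT (EFin \o X).
Hypothesis intY : P.-integrable setT (EFin \o Y).
Hypothesis XY : forall w, Y w = - X w.

Let mem_setb (p : T -> bool) w : (w \in [set w | p w]) = p w.
Proof. by apply/idP/idP => [/set_mem|/mem_set]. Qed.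

Lemma Gfun_pos (x : R) : 0 <= x -> Gfun X x%:E = tilt_cdf X x.
Proof.
move=> x0; rewrite /Gfun lee_fin x0 /tilt_cdf /tilt unlock; congr fine.
rewrite [RHS]integral_mkcond; apply: eq_integral => w _.
rewrite patchE /= indicE !mem_setb lte_fin lee_fin.
have [Xx|Xx] := leP (X w) x; last by rewrite andbF mulr0.
by have [X0|X0] := ltP 0 (X w); rewrite ?mulr1 ?mulr0.
Qed.

Lemma Gfun_neg (x : R) : x <= 0 -> Gfun X x%:E = tilt_cdf Y (- x).
Proof.
rewrite le_eqVlt => /predU1P[->|x0].
  by rewrite Gfun_pos// !tilt_cdf_le0// oppr0.
rewrite /Gfun lee_fin (lt_geF x0) /tilt_cdf /tilt unlock; congr fine.
rewrite [RHS]integral_mkcond; apply: eq_integral => w _.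
rewrite patchE /= indicE !mem_setb lte_fin lee_fin XY lerN2.
have [Xx|Xx] := leP x (X w); last by rewrite mulr0.
have [X0|X0] := ltP (X w) 0; first by rewrite mulr1 max_l// oppr_ge0 ltW.
by rewrite mulr0 max_r// oppr_le0.
Qed.

Lemma Gleft_pos (x : R) : 0 < x -> Gleft X x = tilt_cdfl X x.
Proof.
move=> x0; rewrite /Gleft; apply/cvg_lim => //.

apply: (cvg_trans _ (cvg_tilt_cdf_left intX (x := x))); apply: near_eq_cvg.
near=> y; rewrite Gfun_pos//.
by near: y; exact: nbhs_left_ge.
Unshelve. all: by end_near. Qed.

(** G is continuous at the origin, since the distribution function of the
    negative tail is continuous on the right. *)
Lemma Gleft0 : Gleft X 0 = 0.
Proof.
have K0 : tilt_cdf Y y @[y --> (0 : R)^'+] --> (0 : R).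
  by rewrite -[X in _ --> X](@tilt_cdf_le0 _ _ _ _ Y 0)//; exact: cvg_tilt_cdf_right.
rewrite /Gleft; apply/cvg_lim => //; rewrite -[X in X^'-]oppr0 at_leftN.
rewrite -[X in X `=>` _]/(Gfun X (- y)%:E @[y --> (0 : R)^'+]).
apply: (cvg_trans _ K0); apply: near_eq_cvg; near=> y.
rewrite Gfun_neg ?opprK//= oppr_le0.
by near: y; exact: nbhs_right_ge.
Unshelve. all: by end_near. Qed.

Lemma Gright_neg (x : R) : x < 0 -> Gright X x = tilt_cdfl Y (- x).
Proof.
move=> x0; rewrite /Gright; apply/cvg_lim => //; rewrite -{1}(opprK x) at_rightN.
rewrite -[X in X `=>` _]/(Gfun X (- y)%:E @[y --> (- x)^'-]).
apply: (cvg_trans _ (cvg_tilt_cdf_left intY (x := - x))); apply: near_eq_cvg.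
near=> y; rewrite /= Gfun_neg ?opprK// oppr_le0.
by near: y; apply: nbhs_left_ge; rewrite oppr_gt0.
Unshelve. all: by end_near. Qed.

Lemma Hfun0 (u : R) : Hfun X 0 u = 0.
Proof. by rewrite /Hfun lexx Gleft0 Gfun_pos// tilt_cdf_le0// subr0 mulr0 addr0. Qed.

Lemma Hfun_pos (V : T -> R) w : 0 < X w -> Hfun X (X w) (V w) = tilt_rank X V w.
Proof. by move=> X0; rewrite /Hfun /tilt_rank ltW// Gleft_pos// Gfun_pos// ltW. Qed.

Lemma Hfun_neg (V : T -> R) w : X w < 0 -> Hfun X (X w) (V w) = tilt_rank Y V w.
Proof.
by move=> X0; rewrite /Hfun /tilt_rank lt_geF// Gright_neg// Gfun_neg ?XY// ltW.
Qed.

Lemma xplus_ge0 (h : R) : (0 <= xplus X h)%E.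
Proof. by apply: le_ereal_inf_tmp => x []. Qed.

Lemma xminus_le0 (h : R) : (xminus X h <= 0)%E.
Proof. by apply: ge_ereal_sup => x []. Qed.

Lemma xplus_nd : {homo xplus X : h k / h <= k >-> (h <= k)%E}.
Proof.
by move=> h k hk; apply: ereal_inf_le_tmp => x [x0 kx]; split=> //; exact: le_trans kx.
Qed.

Lemma xminus_ni : {homo xminus X : h k / h <= k >-> (k <= h)%E}.
Proof.
by move=> h k hk; apply: ereal_sup_le => x [x0 kx]; split=> //; exact: le_trans kx.
Qed.

Lemma xplus0 : xplus X 0 = 0%E.
Proof.
apply/eqP; rewrite eq_le xplus_ge0 andbT; apply: ereal_inf_lbound.
by split=> //; rewrite Gfun_pos// tilt_cdf_ge0.
Qed.

Lemma xminus0 : xminus X 0 = 0%E.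
Proof.
apply/eqP; rewrite eq_le xminus_le0/=; apply: ereal_sup_ubound.
by split=> //; rewrite Gfun_pos// tilt_cdf_ge0.
Qed.

(** This is how x_+ inverts the rank: the infimum that defines it is attained,
    at x. *)
Lemma xplus_quantile (x h : R) : 0 <= x -> h <= tilt_cdf X x ->
  (forall y, y < x -> tilt_cdf X y < h) -> xplus X h = x%:E.
Proof.
move=> x0 hx xh; apply/eqP; rewrite eq_le; apply/andP; split.
  by apply: ereal_inf_lbound; split; rewrite ?lee_fin// Gfun_pos.
apply: le_ereal_inf_tmp => -[y|_|[]//] => [[]|]; last exact: leey.
rewrite !lee_fin => y0; rewrite Gfun_pos// => hy.
by rewrite leNgt; apply/negP => /xh; rewrite ltNge hy.
Qed.

Lemma xminus_quantile (x h : R) : 0 <= x -> h <= tilt_cdf Y x ->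
  (forall y, y < x -> tilt_cdf Y y < h) -> xminus X h = (- x)%:E.
Proof.
move=> x0 hx xh; apply/eqP; rewrite eq_le; apply/andP; split; last first.
  apply: ereal_sup_ubound; split; rewrite ?lee_fin ?oppr_le0//.
  by rewrite Gfun_neg ?opprK ?oppr_le0.
apply: ge_ereal_sup => -[y|[]//|_] => [[]|]; last exact: leNye.
rewrite !lee_fin => y0; rewrite Gfun_neg// => hy.
by rewrite lerNr leNgt; apply/negP => /xh; rewrite ltNge hy.
Qed.

Lemma measurable_xplus : measurable_fun setT (xplus X).
Proof.
apply: (measurability _ (ErealGenCInfty.measurableE R)) => //.
move=> _ [_ [r ->] <-]; rewrite setTI; apply: is_interval_measurable.
move=> s t /=; rewrite !in_itv/= !andbT => rs _ u /andP[su _].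
by rewrite in_itv/= andbT (le_trans rs)// xplus_nd.
Qed.

Lemma measurable_xminus : measurable_fun setT (xminus X).
Proof.
apply: (measurability _ (ErealGenCInfty.measurableE R)) => //.
move=> _ [_ [r ->] <-]; rewrite setTI; apply: is_interval_measurable.
move=> s t /=; rewrite !in_itv/= !andbT => _ rt u /andP[_ ut].
by rewrite in_itv/= andbT (le_trans rt)// xminus_ni.
Qed.

End reciprocation.

(** * The reciprocal and the balance of the gap *)

Section tilt_null_transfer.
Context {d : measure_display} {T : measurableType d} {R : realType}
  {P : probability T R}.
Variables (Z1 Z2 : {RV P >-> R}) (H1 H2 : T -> R).
Hypotheses (intZ1 : P.-integrable setT (EFin \o Z1)).
Hypotheses (mH1 : measurable_fun setT H1) (mH2 : measurable_fun setT H2).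
Hypothesis H12 : forall t,
  tilt Z1 [set w | H1 w < t] = tilt Z2 [set w | H2 w < t].

(** The transfer of integrals, applied to an indicator: an event about the
    rank that is null on one side of the origin is null on the other. *)
Lemma tilt_null_transfer (A : set R) : measurable A ->
  {ae P, forall w, 0 < Z2 w -> ~ A (H2 w)} ->
  {ae P, forall w, 0 < Z1 w -> ~ A (H1 w)}.
Proof.
move=> mA A2.
have mind H (Z : {RV P >-> R}) : measurable_fun setT H ->
    measurable_fun setT (fun w => (\1_A (H w) * Num.max (Z w) 0)%:E).
  move=> mH; apply/measurable_EFinP; apply: measurable_funM.
    exact: (measurableT_comp (measurable_indic mA) mH).
  exact: measurable_maxr.
have I2 : (\int[P]_w (\1_A (H2 w) * Num.max (Z2 w) 0)%:E = 0)%E.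
  rewrite (ae_eq_integral (cst 0%E))//; [exact: integral0|exact: mind|].
  apply: filterS A2 => w A2 _ /=; have [Z0|Z0] := ltP 0 (Z2 w); last by rewrite mulr0.
  by rewrite indicE memNset ?mul0r//; exact: A2.
have : (\int[P]_w `|(\1_A (H1 w) * Num.max (Z1 w) 0)%:E| = 0)%E.
  rewrite -[RHS]I2 -(integral_tilt_transfer intZ1 mH1 mH2 H12)//.
  apply: eq_integral => w _; rewrite gee0_abs// lee_fin mulr_ge0//.
  by rewrite le_max lexx orbT.
move/(ae_eq_integral_abs P measurableT (mind _ Z1 mH1)).
apply: filterS => w /(_ I) /= [] /[swap] Z0 /[swap] AH.
rewrite indicE mem_set// mul1r max_l ?ltW// => ZE.
by rewrite ZE ltxx in Z0.
Qed.

End tilt_null_transfer.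

Section zero_mean_reciprocation.
Context {d : measure_display} {T : measurableType d} {R : realType}
  {P : probability T R}.
Variables X U : {RV P >-> R}.
Hypothesis X_mean0 : zero_mean X.
Hypothesis U_uniform : uniform01 U.
Hypothesis XU_indep : independent X U.

Let Y : {RV P >-> R} := \- X.
(** U_X clipped to the unit interval, where it lies almost surely: the bounds
    on the rank then hold everywhere. *)
Let V (w : T) : R := Num.min 1 (Num.max 0 (UX X U w)).
Let HX := tilt_rank X V.
Let HY := tilt_rank Y V.

Let intX : P.-integrable setT (EFin \o X). Proof. exact: X_mean0.1. Qed.

Let intY : P.-integrable setT (EFin \o Y).
Proof.
by apply: eq_integrable (integrableN intX).
Qed.

Let mV : measurable_fun setT V.
Proof.
apply: measurable_minr => //; apply: measurable_maxr => //.
exact: measurable_UX.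
Qed.

Let V01 w : 0 <= V w <= 1.
Proof. by rewrite /V le_min ler01 le_max lexx/= ge_min lexx. Qed.

Lemma uniform01_lt (s : R) : 0 <= s <= 1 -> P [set w | U w < s] = s%:E.
Proof.
move=> /andP[s0 s1].
rewrite -[LHS]/(distribution P U [set x | x < s]) -set_itvNyo U_uniform//.
rewrite /uniform_prob integral_uniform_pdf.
rewrite (_ : _ `&` _ = `[0, s[%classic); last first.
  apply/seteqP; split=> x /=; rewrite !in_itv/=; first by case=> -> /andP[->].
  by move=> /andP[x0 xs]; rewrite xs x0 (le_trans (ltW xs)).
rewrite (eq_integral (fun=> 1%E)); last first.
  move=> x; rewrite inE/= in_itv/= => /andP[x0 xs].
  by rewrite /uniform_pdf x0 (le_trans (ltW xs))// subr0 invr1.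
rewrite integral_cst//= mul1e lebesgue_measure_itv/= lte_fin.
by move: s0; rewrite le_eqVlt => /predU1P[<-|->]; rewrite ?ltxx// sube0.
Qed.

Lemma uniform01_ae : {ae P, forall w, 0 <= U w <= 1}.
Proof.
have m01 : measurable (U @^-1` `[0, 1]%classic).
  by rewrite -[X in measurable X]setTI; apply: measurable_funP.
exists (~` (U @^-1` `[0, 1]%classic)); split.
- exact: measurableC.
- have P1 : P (U @^-1` `[0, 1]) = 1%E.
    rewrite -[LHS]/(distribution P U `[0, 1]%classic) U_uniform//.
    exact: integral_uniform_pdf1.
  by rewrite probability_setC// P1 subee.
- by move=> w /= + U01; apply; move: U01; rewrite /= in_itv.
Qed.

Let V_atomX x s : pmf X x != 0 -> 0 <= s <= 1 ->
  P ([set w | X w = x] `&` [set w | V w < s]) = (pmf X x * s)%:E.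
Proof.
move=> px /andP[s0 s1].
have -> : P ([set w | X w = x] `&` [set w | V w < s]) =
    P (X @^-1` [set x] `&` U @^-1` [set u | u < s]).
  (* clipping empties the event V < 0, while U < 0 is only null *)
  move: s0; rewrite le_eqVlt => /predU1P[<-|s0].
    rewrite (_ : _ `&` [set w | V w < 0] = set0); last first.
      apply/seteqP; split=> w //= -[_]; have /andP[V0 _] := V01 w.
      by rewrite ltNge V0.
    rewrite measure0; apply/esym/eqP; rewrite -measure_le0.
    have P0 : P [set w | U w < 0] = 0%E by rewrite uniform01_lt ?lexx ?ler01.
    rewrite -P0; apply: le_measure; last by move=> w [].
      rewrite inE; apply: measurableI.
        by rewrite -[X in measurable X]setTI; apply: measurable_funP.
      rewrite -[X in measurable X]setTI -set_itvNyo.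
      by apply: measurable_funP.
    rewrite inE -[X in measurable X]setTI.
    rewrite -[X in _ `&` X]/(U @^-1` [set u | u < 0]) -set_itvNyo.
    by apply: measurable_funP.
  congr (P _); apply/seteqP; split=> w /= [Xx]; rewrite /V /UX /Uat Xx px.
    by rewrite gt_min ltNge s1/= gt_max => /andP[].
  by move=> Us; split=> //; rewrite gt_min gt_max s0 Us orbT.
rewrite XU_indep//; last by rewrite -set_itvNyo.
rewrite -[X in (_ * X)%E]/(P [set w | U w < s]) uniform01_lt ?s0// EFinM.
rewrite /pmf fineK//; apply: fin_num_measure.
by rewrite -[X in measurable X]setTI; apply: measurable_funP.
Qed.

Let V_atomY x s : pmf Y x != 0 -> 0 <= s <= 1 ->
  P ([set w | Y w = x] `&` [set w | V w < s]) = (pmf Y x * s)%:E.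
Proof.
have Yx : Y @^-1` [set x] = X @^-1` [set - x].
  apply/seteqP; split=> w /=; first by move=> <-; rewrite opprK.
  by rewrite /Y/= => ->; rewrite opprK.
rewrite -[[set w | Y w = x]]/(Y @^-1` [set x]) /pmf Yx; exact: V_atomX.
Qed.

Let tilt_mass_eq : tilt_mass X = tilt_mass Y.
Proof.
have := X_mean0.2; rewrite unlock integralE.
have -> : (\int[P]_w (EFin \o X)^\+ w)%E = tilt X setT.
  by apply: eq_integral => w _; rewrite funeposE /= EFin_max.
have -> : (\int[P]_w (EFin \o X)^\- w)%E = tilt Y setT.
  by apply: eq_integral => w _; rewrite funenegE /= EFin_max.
by rewrite !tilt_massE// -EFinB => /eqP; rewrite eqe subr_eq0 => /eqP.
Qed.

Let HXY t : tilt X [set w | HX w < t] = tilt Y [set w | HY w < t].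
Proof. by rewrite !tilt_rank_law// tilt_mass_eq. Qed.

Let mHX : measurable_fun setT HX. Proof. exact: measurable_tilt_rank. Qed.

Let mHY : measurable_fun setT HY. Proof. exact: measurable_tilt_rank. Qed.

Let XY w : Y w = - X w. Proof. by []. Qed.

Let V_UX : {ae P, forall w, V w = UX X U w}.
Proof.
apply: filterS uniform01_ae => w /andP[U0 U1]; rewrite /V /UX /Uat.
by case: ifPn => _; rewrite ?max_r ?min_r ?ler01.
Qed.

Let xplus_HX : {ae P, forall w, 0 < X w -> xplus X (HX w) = (X w)%:E}.
Proof.
apply: filterS (tilt_rank_gt intX mV V01 V_atomX) => w KH X0.
apply: xplus_quantile (KH X0); first exact: ltW.
exact: tilt_rank_le.
Qed.

Let xminus_HY : {ae P, forall w, 0 < Y w -> xminus X (HY w) = (X w)%:E}.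
Proof.
apply: filterS (tilt_rank_gt intY mV V01 V_atomY) => w KH Y0.
rewrite (xminus_quantile XY (ltW Y0) _ (KH Y0)) ?XY ?opprK//.
exact: tilt_rank_le.
Qed.

(** Where X < 0, x_- at the rank is X, hence finite; this transfers to the
    event X > 0. *)
Let xminus_HX_fin : {ae P, forall w, 0 < X w -> xminus X (HX w) \is a fin_num}.
Proof.
pose A := [set h | xminus X h = -oo%E].
have mA : measurable A.
  rewrite -[X in measurable X]setTI -[X in _ `&` X]/(xminus X @^-1` [set -oo%E]).
  by apply: measurable_xminus.
apply: filterS (tilt_null_transfer intX mHX mHY HXY mA _).
  move=> w AH /AH; rewrite /A/=; have := xminus_le0 X (HX w).
  by case: xminus.
by apply: filterS xminus_HY => w /[swap] Y0 /(_ Y0); rewrite /A/= => ->.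
Qed.

Let xplus_HY_fin : {ae P, forall w, 0 < Y w -> xplus X (HY w) \is a fin_num}.
Proof.
pose A := [set h | xplus X h = +oo%E].
have mA : measurable A.
  rewrite -[X in measurable X]setTI -[X in _ `&` X]/(xplus X @^-1` [set +oo%E]).
  by apply: measurable_xplus.
apply: filterS (tilt_null_transfer intY mHY mHX (fun t => esym (HXY t)) mA _).
  move=> w AH /AH; rewrite /A/=; have := xplus_ge0 X (HY w).
  by case: xplus.
by apply: filterS xplus_HX => w /[swap] X0 /(_ X0); rewrite /A/= => ->.
Qed.

Let h (w : T) : R := Hfun X (X w) (UX X U w).

Let h_HX : {ae P, forall w, 0 < X w -> h w = HX w}.
Proof.
by apply: filterS V_UX => w Vw X0; rewrite /h -Vw; exact: Hfun_pos.
Qed.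

Let h_HY : {ae P, forall w, 0 < Y w -> h w = HY w}.
Proof.
apply: filterS V_UX => w Vw; rewrite oppr_gt0 => X0; rewrite /h -Vw.
exact: Hfun_neg.
Qed.

Let h0 w : X w = 0 -> h w = 0.
Proof. by move=> X0; rewrite /h X0 (Hfun0 intY XY). Qed.

Lemma recip_origin w : X w = 0 -> recip X (X w) (UX X U w) = 0%E.
Proof. by move=> X0; rewrite /recip -/(h w) X0 lexx h0// xminus0. Qed.

(** The null sets are those of [tilt_rank_gt] for X and - X, those on which a
    quantile is infinite, and the one on which U leaves the unit interval. *)
Lemma recip_quantiles : {ae P, forall w,
  [/\ xplus X (h w) \is a fin_num, xminus X (h w) \is a fin_num &
    (X w)%:E = (if 0 <= X w then xplus X (h w) else xminus X (h w))]}.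
Proof.
apply: filterS2 (filterI xplus_HX xminus_HY)
  (filterI (filterI h_HX h_HY) (filterI xminus_HX_fin xplus_HY_fin)).
move=> w [pX mY] [[hX hY] [fX fY]].
have [X0|X0|X0] := ltgtP (X w) 0.
- have Y0 : 0 < Y w by rewrite oppr_gt0.
  by rewrite hY// mY// fY.
- by rewrite hX// pX// fX.
- by rewrite h0// X0 xplus0 ?xminus0.
Qed.

Lemma recipE w : recip X (X w) (UX X U w) =
  if 0 <= X w then xminus X (h w) else xplus X (h w).
Proof. by []. Qed.

Lemma gapE w : xplus X (h w) \is a fin_num -> xminus X (h w) \is a fin_num ->
  (X w)%:E = (if 0 <= X w then xplus X (h w) else xminus X (h w)) ->
  gap X U w = (xplus X (h w) - xminus X (h w))%E.
Proof.
move=> fp fm Xw; rewrite /gap recipE Xw.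
have p0 := xplus_ge0 X (h w); have m0 := xminus_le0 X (h w).
move: p0 m0; rewrite -(fineK fp) -(fineK fm) !lee_fin => p0 m0.
case: ifPn => _; rewrite -EFinB abse_EFin; congr EFin.
  by rewrite ger0_norm// subr_ge0 (le_trans m0).
by rewrite distrC ger0_norm// subr_ge0 (le_trans m0).
Qed.

Let gap_HX : {ae P, forall w, 0 < X w ->
  gap X U w = (xplus X (HX w) - xminus X (HX w))%E}.
Proof.
apply: filterS2 recip_quantiles h_HX => w [fp fm Xw] hX X0.
by rewrite gapE// hX.
Qed.

Let gap_HY : {ae P, forall w, 0 < Y w ->
  gap X U w = (xplus X (HY w) - xminus X (HY w))%E}.
Proof.
apply: filterS2 recip_quantiles h_HY => w [fp fm Xw] hY Y0.
by rewrite gapE// hY.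
Qed.

(** The gap is x_+ - x_- at the rank on either side of the origin, and the rank
    has the same law under both weights; this is E(X | W) = 0. *)
Lemma integral_gap_balanced (psi : R -> R) : measurable_fun setT psi ->
  (forall v, 0 <= psi v) ->
  (\int[P]_w (psi (fine (gap X U w)) * Num.max (X w) 0)%:E =
   \int[P]_w (psi (fine (gap X U w)) * Num.max (- X w) 0)%:E)%E.
Proof.
move=> mpsi psi0.
have mg : measurable_fun setT (fun w => psi (fine (gap X U w))).
  apply: (measurableT_comp mpsi).
  exact: (measurableT_comp (fine_measurable measurableT) (measurable_gap X U)).
pose phi x := psi (fine (xplus X x - xminus X x)%E).
have mphi : measurable_fun setT phi.
  apply: (measurableT_comp mpsi).
  apply: (measurableT_comp (fine_measurable measurableT)).
  by apply: emeasurable_funB; [exact: measurable_xplus|exact: measurable_xminus].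
have mprod (f : T -> R) (Z : {RV P >-> R}) : measurable_fun setT f ->
    measurable_fun setT (fun w => (f w * Num.max (Z w) 0)%:E).
  move=> mf; apply/measurable_EFinP; apply: measurable_funM => //.
  exact: measurable_maxr.
transitivity (\int[P]_w (phi (HX w) * Num.max (X w) 0)%:E)%E.
  apply: ae_eq_integral => //; [exact: mprod| |].
    by apply: mprod; exact: (measurableT_comp mphi).
  apply: filterS gap_HX => w gw _; have [X0|X0] := ltP 0 (X w); last by rewrite !mulr0.
  by rewrite gw.
rewrite (integral_tilt_transfer intX mHX mHY HXY mphi) => [|x]; last exact: psi0.
apply/esym/ae_eq_integral => //; [exact: (mprod _ Y)| |].
  by apply: mprod; exact: (measurableT_comp mphi).
apply: filterS gap_HY => w gw _ /=; have [Y0|Y0] := ltP 0 (Y w).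
  by rewrite gw// max_l// ltW.
by rewrite ?max_r ?mulr0.
Qed.

End zero_mean_reciprocation.

(** * The splitting of the gap *)

Lemma nonexpansive_within_continuous (R : realType) (A : set R) (f : R -> R) :
  (forall u v, A u -> A v -> u <= v -> `|f v - f u| <= v - u) ->
  {within A, continuous f}.
Proof.
move=> f1; apply/subspace_continuousP => x Ax; apply/cvgrPdist_lt => e e0.
rewrite near_withinE; near=> y => Ay.
have xy : `|x - y| < e by near: y; exact: cvgr_dist_lt.
have [/f1|/ltW/f1] := leP x y.
  move=> /(_ Ax Ay) h; rewrite distrC (le_lt_trans h)//.
  by rewrite (le_lt_trans _ xy)// distrC ler_norm.
by move=> /(_ Ay Ax) h; rewrite (le_lt_trans h)// (le_lt_trans _ xy)// ler_norm.
Unshelve. all: by end_near. Qed.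

Section gap_splitting_existence.
Context {d : measure_display} {T : measurableType d} {R : realType}
  {P : probability T R}.
Variables X U : {RV P >-> R}.
Hypothesis X_mean0 : zero_mean X.
Hypothesis U_uniform : uniform01 U.
Hypothesis XU_indep : independent X U.

Let h (w : T) : R := Hfun X (X w) (UX X U w).
Let p (w : T) : R := fine (xplus X (h w)).
Let m (w : T) : R := fine (xminus X (h w)).

Let good (w : T) := [/\ xplus X (h w) \is a fin_num,
  xminus X (h w) \is a fin_num &
  (X w)%:E = (if 0 <= X w then xplus X (h w) else xminus X (h w))].

Let good_gap w : good w -> gap X U w = (p w - m w)%:E.
Proof. by case=> fp fm Xw; rewrite gapE// EFinB !fineK. Qed.

Let good_pair w : good w ->
  [set (X w)%:E; recip X (X w) (UX X U w)] = [set (m w)%:E; (p w)%:E].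
Proof.
case=> fp fm ->; rewrite recipE !fineK//.
by case: ifP => // _; rewrite setUC.
Qed.

Let p_ge0 w : good w -> 0 <= p w.
Proof. by move=> [fp _ _]; rewrite fine_ge0// xplus_ge0. Qed.

Let m_le0 w : good w -> m w <= 0.
Proof. by move=> [_ fm _]; rewrite fine_le0// xminus_le0. Qed.

(** The quantiles move apart as the rank grows, so that their distance orders
    both of them; when the ranks are in the opposite order, the quantiles
    coincide. *)
Let good_le w w' : good w -> good w' -> p w - m w <= p w' - m w' ->
  p w <= p w' /\ m w' <= m w.
Proof.
move=> [fp fm _] [fp' fm' _] le_gap.
have homo u u' : xplus X (h u) \is a fin_num -> xplus X (h u') \is a fin_num ->
    xminus X (h u) \is a fin_num -> xminus X (h u') \is a fin_num ->
    h u <= h u' -> p u <= p u' /\ m u' <= m u.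
  move=> fpu fpu' fmu fmu' hu; split.
    exact: (fine_le fpu fpu' (xplus_nd X hu)).
  exact: (fine_le fmu' fmu (xminus_ni X hu)).
have [hle|/ltW hle] := leP (h w) (h w'); first exact: homo fp fp' fm fm' hle.
have [pp mm] := homo _ _ fp' fp fm' fm hle.
move: (p w) (p w') (m w) (m w') le_gap pp mm => a a' b b' {fp fm fp' fm' hle homo}.
by move=> *; split; lra.
Qed.

Lemma ordered_splitting : exists (Omega0 : set T) (p m : T -> R),
  [/\ measurable Omega0 /\ P Omega0 = 1%E,
      forall w, Omega0 w -> [/\ gap X U w = (p w - m w)%:E,
        [set (X w)%:E; recip X (X w) (UX X U w)] = [set (m w)%:E; (p w)%:E],
        0 <= p w & m w <= 0] &
      forall w w', Omega0 w -> Omega0 w' -> p w - m w <= p w' - m w' ->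
        p w <= p w' /\ m w' <= m w].
Proof.
have [N [mN N0 goodN]] := recip_quantiles X_mean0 U_uniform XU_indep.
have Ngood w : (~` N) w -> good w.
  by move=> Nw; apply: contrapT => ng; apply/Nw/goodN.
exists (~` N), p, m; split.
- split; first exact: measurableC.
  by rewrite probability_setC// N0 sube0.
- move=> w /Ngood gw; split.
  + exact: good_gap.
  + exact: good_pair.
  + exact: p_ge0.
  + exact: m_le0.
- move=> w w' /Ngood gw /Ngood gw'; exact: good_le.
Qed.

(** At v, e takes the positive quantile of any outcome of gap v, and c is
    e - v.  For u <= v the increments e v - e u and c u - c v are nonnegative
    with sum v - u, so that both functions are nonexpansive. *)
Lemma gap_splitting_exists :
  exists (Omega0 : set T) (c e : R -> R), gap_splitting X U Omega0 c e.
Proof.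
case: ordered_splitting => Omega0 [a [b [[mO PO] Oab Ole]]].
pose e v := xget 0 [set x | exists w, [/\ Omega0 w, gap X U w = v%:E & a w = x]].
pose c v := e v - v.
have V0P v : gap_values X U Omega0 v ->
    exists w, [/\ Omega0 w, v = a w - b w, e v = a w & c v = b w].
  move=> [w Ow gw].
  have : exists x w, [/\ Omega0 w, gap X U w = v%:E & a w = x].
    by exists (a w), w.
  move=> /(xgetPex 0) [w' [Ow' gw' aw']]; exists w'.
  have vE : v = a w' - b w'.
    by apply: EFin_inj; rewrite -gw'; have [] := Oab _ Ow'.
  have eE : e v = a w' by rewrite aw'.
  by split=> //; rewrite /c eE vE; ring.
have mono u v : gap_values X U Omega0 u -> gap_values X U Omega0 v -> u <= v ->
    e u <= e v /\ c v <= c u.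
  by move=> /V0P[w [Ow -> -> ->]] /V0P[w' [Ow' -> -> ->]]; exact: Ole.
exists Omega0, c, e; split => //.
- split=> v /V0P[w [/Oab[_ _ a0 b0] _]]; last by move=> ->.
  by move=> _ ->.
- split; apply: nonexpansive_within_continuous => u v Vu Vv uv;
    have [euv cuv] := mono _ _ Vu Vv uv; move: cuv; rewrite /c => cuv.
    by rewrite ler_norml; lra.
  by rewrite ger0_norm; lra.
- split=> u v Vu Vv uv; have [euv cuv] := mono _ _ Vu Vv uv => //.
  by rewrite lerN2.
- move=> w Ow; have [gw pw _ _] := Oab _ Ow; exists (a w - b w); split=> //.
  + have /V0P[w' [Ow' vE -> ->]] : gap_values X U Omega0 (a w - b w) by exists w.
    have le1 : a w - b w <= a w' - b w' by rewrite vE lexx.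
    have le2 : a w' - b w' <= a w - b w by rewrite vE lexx.
    have [aw bw] := Ole _ _ Ow Ow' le1.
    have [aw' bw'] := Ole _ _ Ow' Ow le2.
    have -> : a w' = a w by apply/eqP; rewrite eq_le aw aw'.
    by have -> : b w' = b w by apply/eqP; rewrite eq_le bw bw'.
  + by rewrite /c; ring.
Qed.

End gap_splitting_existence.

(** * Disintegration along the gap *)

(** The inverse is not continuous at 0, but it is a power on the nonnegative
    half-line. *)
Lemma measurable_funV_ge0 d (T : measurableType d) (R : realType)
    (f : T -> R) : measurable_fun setT f -> (forall x, 0 <= f x) ->
  measurable_fun setT (fun x => (f x)^-1).
Proof.
move=> mf f0; rewrite (_ : (fun x => _) = (@powR R ^~ (-1)) \o f).
  exact: (measurableT_comp (measurable_powR _) mf).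
by apply/funext => x /=; rewrite powR_inv1.
Qed.

Lemma integral_full_measure d (T : measurableType d) (R : realType)
    (P : probability T R) (A : set T) (f : T -> \bar R) :
  measurable A -> P A = 1%E -> measurable_fun setT f ->
  (forall w, 0 <= f w)%E -> (\int[P]_(w in A) f w = \int[P]_w f w)%E.
Proof.
move=> mA A1 mf f0; rewrite [RHS](@ge0_negligible_integral _ _ _ _ _ (~` A))//.
- by rewrite setTD setCK.
- exact: measurableC.
- by rewrite -[LHS]/(P (~` A)) probability_setC// A1 subee.
Qed.

Lemma expectation_two_point d (T : measurableType d) (R : realType)
    (P : probability T R) (D : {RV P >-> R}) (a b p q : R) (f : R -> R) :
  a != b -> p + q = 1 ->
  distribution P D [set a] = p%:E -> distribution P D [set b] = q%:E ->
  measurable_fun setT f -> ('E_P[f \o D] = (f a * p + f b * q)%R%:E)%E.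
Proof.
move=> ab pq Da Db mf.
have mD x : measurable (D @^-1` [set x]).
  by rewrite -[X in measurable X]setTI; apply: measurable_funP.
have mI x : measurable_fun setT (fun w => (f x * \1_(D @^-1` [set x]) w)%:E).
  by apply/measurable_EFinP/measurable_funM => //; exact: measurable_indic.
have iI x : P.-integrable setT (fun w => (f x * \1_(D @^-1` [set x]) w)%:E).
  by under eq_fun do rewrite EFinM; apply: integrableZl => //; exact: integrable_indic.
have II x r : distribution P D [set x] = r%:E ->
    (\int[P]_w (f x * \1_(D @^-1` [set x]) w)%:E = (f x * r)%:E)%E.
  move=> Dx; under eq_integral do rewrite EFinM.
  rewrite integralZl//; last exact: integrable_indic.
  by rewrite integral_indic// setIT EFinM -Dx.
rewrite unlock EFinD -(II a p Da) -(II b q Db) -integralD//.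
apply: ae_eq_integral => //.
- by apply/measurable_EFinP; exact: measurableT_comp.
- exact: emeasurable_funD.
exists (~` (D @^-1` [set a] `|` D @^-1` [set b])); split.
- by apply: measurableC; exact: measurableU.
- have Dab : P (D @^-1` [set a] `|` D @^-1` [set b]) = 1%E.
    rewrite measureU//; last first.
      by apply/seteqP; split=> w //= [-> /eqP]; rewrite (negbTE ab).
    rewrite -[X in (X + _)%E]/(distribution P D [set a]).
    by rewrite -[X in (_ + X)%E]/(distribution P D [set b]) Da Db -EFinD pq.
  rewrite -[LHS]/(P (~` _)) probability_setC ?Dab ?subee//.
  exact: measurableU.
- move=> w /= fD [Dw|Dw]; apply: fD => _; rewrite !indicE Dw.
    by rewrite mem_set// memNset /= ?Dw ?mulr1 ?mulr0 ?adde0//; apply/eqP.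
  by rewrite memNset /= ?Dw ?mem_set ?mulr1 ?mulr0 ?add0e//; apply/eqP; rewrite eq_sym.
Qed.

Section disintegration.
Context {d : measure_display} {T : measurableType d} {R : realType}
  {P : probability T R}.
Variables X U : {RV P >-> R}.
Hypothesis X_mean0 : zero_mean X.
Hypothesis U_uniform : uniform01 U.
Hypothesis XU_indep : independent X U.
Variables (Omega0 : set T) (c e : R -> R).
Hypothesis Oce : gap_splitting X U Omega0 c e.

Let V0 := gap_values X U Omega0.
Let W (w : T) : R := fine (gap X U w).

Let mO : measurable Omega0. Proof. by case: Oce => -[]. Qed.

Let PO : P Omega0 = 1%E. Proof. by case: Oce => -[]. Qed.

Let gapW w : Omega0 w -> gap X U w = (W w)%:E.
Proof. by case: Oce => _ _ _ _ /[apply] -[v [gw _ _]]; rewrite /W gw. Qed.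

Let WV0 w : Omega0 w -> V0 (W w).
Proof. by move=> Ow; exists w => //; exact: gapW. Qed.

Let c_le0 v : V0 v -> c v <= 0.
Proof. by case: Oce => _ [+ _] _ _ _; apply. Qed.

Let e_ge0 v : V0 v -> 0 <= e v.
Proof. by case: Oce => _ [_ +] _ _ _; apply. Qed.

Let ecE v : V0 v -> e v - c v = v.
Proof.
by move=> [w Ow gw]; case: Oce => _ _ _ _ /(_ w Ow)[u [+ _]]; rewrite gw => -[<-].
Qed.

Lemma gap_splitting_norm v : V0 v -> `|c v| + e v = v.
Proof. by move=> Vv; rewrite ler0_norm ?c_le0// addrC ecE. Qed.

Let X_pos w : Omega0 w -> 0 < X w -> X w = e (W w).
Proof.
move=> Ow X0; case: Oce => _ _ _ _ /(_ w Ow)[v [gw pair _]].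
have Vv : V0 v by exists w.
rewrite /W gw /=.
have : [set (c v)%:E; (e v)%:E] (X w)%:E by rewrite -pair; left.
case=> [] [] // Xc; move: X0; rewrite Xc ltNge c_le0//.
Qed.

Let X_neg w : Omega0 w -> X w < 0 -> X w = c (W w).
Proof.
move=> Ow X0; case: Oce => _ _ _ _ /(_ w Ow)[v [gw pair _]].
have Vv : V0 v by exists w.
rewrite /W gw /=.
have : [set (c v)%:E; (e v)%:E] (X w)%:E by rewrite -pair; left.
case=> [] [] // Xe; move: X0; rewrite Xe ltNge e_ge0//.
Qed.

Let X_zero w : X w = 0 -> W w = 0.
Proof.
by move=> X0; rewrite /W /gap (recip_origin U X_mean0 X0) X0 sube0 abse0.
Qed.

(** [V0] need not be Borel, but a nondecreasing extension of e is; the values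
    of e do not exceed their arguments, so that the supremum is finite, and
    over the empty set it is 0. *)
Let ehat (v : R) : R := sup (e @` [set u | V0 u /\ u <= v]).
Let chat (v : R) : R := ehat v - v.

Let ehat_sup v : (exists u, V0 u /\ u <= v) ->
  has_sup (e @` [set u | V0 u /\ u <= v]).
Proof.
move=> [u Vu]; split; first by exists (e u), u.
exists v => _ [x [Vx xv] <-]; apply: le_trans xv.
by rewrite -[leRHS](ecE Vx) lerDl oppr_ge0 c_le0.
Qed.

Let ehatE v : V0 v -> ehat v = e v.
Proof.
move=> Vv; apply/eqP; rewrite eq_le; apply/andP; split.
  apply: ge_sup; first by exists (e v), v.
  by move=> _ [u [Vu uv] <-]; case: Oce => _ _ _ [+ _] _; apply.
by apply: ub_le_sup; [apply: (ehat_sup _).2; exists v|exists v].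
Qed.

Let chatE v : V0 v -> chat v = c v.
Proof. by move=> Vv; rewrite /chat ehatE// -[X in _ - X](ecE Vv); ring. Qed.

Let ehat_ge0 v : 0 <= ehat v.
Proof.
have [[u [Vu uv]]|nV] := pselect (exists u, V0 u /\ u <= v); last first.
  rewrite /ehat (_ : [set u | _] = set0) ?image_set0 ?sup0//.
  by apply/seteqP; split=> u //= Vu; apply: nV; exists u.
have [_ ub] := ehat_sup (ex_intro _ u (conj Vu uv)).
by rewrite (le_trans (e_ge0 Vu))//; apply: ub_le_sup => //; exists u.
Qed.

Let ehat_nd : {homo ehat : u v / u <= v}.
Proof.
move=> u v uv.
have [uV|nV] := pselect (exists x, V0 x /\ x <= u); last first.
  rewrite /ehat (_ : [set x | _] = set0) ?image_set0 ?sup0 ?ehat_ge0//.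
  by apply/seteqP; split=> x //= Vx; apply: nV; exists x.
apply: ge_sup; first by have [] := ehat_sup uV.
move=> _ [x [Vx xu] <-]; apply: ub_le_sup; last first.
  by exists x => //; split=> //; exact: le_trans uv.
by apply: (ehat_sup _).2; exists x; split=> //; exact: le_trans uv.
Qed.

Let mehat : measurable_fun setT ehat.
Proof. by apply: nondecreasing_measurable. Qed.

Let mchat : measurable_fun setT chat.
Proof. exact: measurable_funB. Qed.

(** The mean of F(D_v, v), written with the extensions of c and e so as to be
    Borel on the whole line. *)
Definition two_point_mean (F : R * R -> R) (v : R) : R :=
  if v != 0 then F (chat v, v) * (ehat v / (`|chat v| + ehat v)) +
                 F (ehat v, v) * (`|chat v| / (`|chat v| + ehat v))
  else F (0, 0).

Lemma two_point_meanE F v : V0 v -> two_point_mean F v =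
  if v != 0 then F (c v, v) * (e v / (`|c v| + e v)) +
                 F (e v, v) * (`|c v| / (`|c v| + e v))
  else F (0, 0).
Proof. by move=> Vv; rewrite /two_point_mean chatE// ehatE. Qed.

Let weight_ge0 v : 0 <= `|chat v| + ehat v.
Proof. by rewrite addr_ge0. Qed.

Let mweight : measurable_fun setT (fun v => (`|chat v| + ehat v)^-1).
Proof.
apply: measurable_funV_ge0 => //; apply: measurable_funD => //.
exact: measurableT_comp.
Qed.

Let mF_at (F : R * R -> R) (f : R -> R) : measurable_fun setT F ->
  measurable_fun setT f -> measurable_fun setT (fun v => F (f v, v)).
Proof.
move=> mF mf; apply: (measurableT_comp mF).
exact: measurable_fun_pair.
Qed.

Lemma measurable_two_point_mean (F : R * R -> R) : measurable_fun setT F ->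
  measurable_fun setT (two_point_mean F).
Proof.
move=> mF; apply: measurable_fun_ifT => //.
  by apply: measurable_neg; exact: measurable_fun_eqr.
apply: measurable_funD; apply: measurable_funM; try exact: mF_at.
  exact: measurable_funM.
by apply: measurable_funM => //; exact: measurableT_comp.
Qed.

Lemma two_point_mean_ge0 (F : R * R -> R) : (forall z, 0 <= F z) ->
  forall v, 0 <= two_point_mean F v.
Proof.
move=> F0 v; rewrite /two_point_mean; case: ifP => // _.
by rewrite addr_ge0// mulr_ge0// divr_ge0.
Qed.

Let mW : measurable_fun setT W.
Proof. exact: (measurableT_comp (fine_measurable measurableT) (measurable_gap X U)). Qed.

(** On [Omega0], with p and q the values of F at the two points divided by
    v = W, both integrands are A plus a combination of X^+ and X^- with
    coefficients p and q, in opposite orders; for X > 0 say,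
    F(X, W) = p v = p |c| + p X. *)
Lemma integral_two_point_mean (F : R * R -> R) :
  measurable_fun setT F -> (forall z, 0 <= F z) ->
  (\int[P]_w (F (X w, W w))%:E = \int[P]_w (two_point_mean F (W w))%:E)%E.
Proof.
move=> mF F0.
pose s v := (`|chat v| + ehat v)^-1.
pose p v := F (ehat v, v) * s v.
pose q v := F (chat v, v) * s v.
have s0 v : 0 <= s v by rewrite invr_ge0.
have p0 v : 0 <= p v by rewrite mulr_ge0.
have q0 v : 0 <= q v by rewrite mulr_ge0.
have mp : measurable_fun setT p by apply: measurable_funM => //; exact: mF_at.
have mq : measurable_fun setT q by apply: measurable_funM => //; exact: mF_at.
pose A w := if 0 < X w then p (W w) * `|chat (W w)|
  else if X w < 0 then q (W w) * ehat (W w) else F (0, 0).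
have A0 w : 0 <= A w.
  by rewrite /A; case: ifP => _; [|case: ifP => _//]; rewrite mulr_ge0.
have mA : measurable_fun setT A.
  apply: measurable_fun_ifT; first exact: measurable_fun_ltr.
    apply: measurable_funM; first exact: (measurableT_comp mp).
    by do 2 apply: measurableT_comp => //.
  apply: measurable_fun_ifT => //; first exact: measurable_fun_ltr.
  apply: measurable_funM; first exact: (measurableT_comp mq).
  exact: (measurableT_comp mehat).
pose pos w := Num.max (X w) 0.
pose neg w := Num.max (- X w) 0.
have pos0 w : 0 <= pos w by rewrite le_max lexx orbT.
have neg0 w : 0 <= neg w by rewrite le_max lexx orbT.
have mpos : measurable_fun setT pos by exact: measurable_maxr.
have mneg : measurable_fun setT neg.
  by apply: measurable_maxr => //; exact: measurableT_comp.
have mprod (r : R -> R) (n : T -> R) : measurable_fun setT r ->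
    measurable_fun setT n -> measurable_fun setT (fun w => (r (W w) * n w)%:E).
  move=> mr mn; apply/measurable_EFinP; apply: measurable_funM => //.
  exact: (measurableT_comp mr).
have split3 (r t : R -> R) (n m : T -> R) :
    measurable_fun setT r -> measurable_fun setT t ->
    measurable_fun setT n -> measurable_fun setT m ->
    (forall v, 0 <= r v) -> (forall v, 0 <= t v) ->
    (forall w, 0 <= n w) -> (forall w, 0 <= m w) ->
    (\int[P]_w (A w + (r (W w) * n w + t (W w) * m w))%:E =
     \int[P]_w (A w)%:E + (\int[P]_w (r (W w) * n w)%:E +
       \int[P]_w (t (W w) * m w)%:E))%E.
  move=> mr mt mn mm r0 t0 n0 m0.
  have rn0 w : 0 <= r (W w) * n w by rewrite mulr_ge0.
  have tm0 w : 0 <= t (W w) * m w by rewrite mulr_ge0.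
  under eq_integral do rewrite !EFinD.
  rewrite ge0_integralD//; first last.
  - by apply: emeasurable_funD; exact: mprod.
  - by move=> w _; rewrite -EFinD lee_fin addr_ge0.
  - exact/measurable_EFinP.
  - by move=> w _; rewrite lee_fin.
  congr (_ + _)%E; rewrite ge0_integralD//.
  - by move=> w _; rewrite lee_fin.
  - exact: mprod.
  - by move=> w _; rewrite lee_fin.
  - exact: mprod.
have onO (f g : T -> R) : measurable_fun setT f -> measurable_fun setT g ->
    (forall w, 0 <= f w) -> (forall w, 0 <= g w) ->
    (forall w, Omega0 w -> f w = g w) ->
    (\int[P]_w (f w)%:E = \int[P]_w (g w)%:E)%E.
  move=> mf mg f0 g0 fg.
  have full (k : T -> R) : measurable_fun setT k -> (forall w, 0 <= k w) ->
      (\int[P]_w (k w)%:E = \int[P]_(w in Omega0) (k w)%:E)%E.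
    move=> mk k0; apply/esym/integral_full_measure => //.
    exact/measurable_EFinP.
  rewrite (full f)// (full g)//.
  by apply: eq_integral => w /set_mem Ow; rewrite fg.
have mid_ge0 (r t : R -> R) : (forall v, 0 <= r v) -> (forall v, 0 <= t v) ->
    forall w, 0 <= A w + (r (W w) * pos w + t (W w) * neg w).
  by move=> r0 t0 w; rewrite !addr_ge0// mulr_ge0.
have mmid (r t : R -> R) : measurable_fun setT r -> measurable_fun setT t ->
    measurable_fun setT (fun w => A w + (r (W w) * pos w + t (W w) * neg w)).
  move=> mr mt; apply: measurable_funD => //.
  by apply: measurable_funD; apply: measurable_funM => //; exact: measurableT_comp.
have bal (r : R -> R) : measurable_fun setT r -> (forall v, 0 <= r v) ->
    (\int[P]_w (r (W w) * pos w)%:E = \int[P]_w (r (W w) * neg w)%:E)%E.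
  exact: (integral_gap_balanced X_mean0 U_uniform XU_indep).
transitivity (\int[P]_w (A w + (p (W w) * pos w + q (W w) * neg w))%:E)%E.
  apply: onO => //; [|exact: mmid|exact: mid_ge0|].
    apply: (measurableT_comp mF); exact: measurable_fun_pair.
  move=> w Ow; rewrite /A /pos /neg /p /q /s.
  have Vw := WV0 Ow; rewrite ehatE// chatE// gap_splitting_norm//.
  have ec := ecE Vw; have [c0 e0] := (c_le0 Vw, e_ge0 Vw).
  have [X0|X0|X0] := ltgtP 0 (X w).
  - have Xe := X_pos Ow X0; move: X0; rewrite Xe => X0.
    rewrite max_r ?oppr_le0 ?(ltW X0)// ler0_norm//.
    have W0 : W w != 0 by rewrite gt_eqF// -ec ltr_wpDr// oppr_ge0.
    rewrite mulr0 addr0 -mulrDr [- _ + _]addrC ec -mulrA mulVf// mulr1//.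
  - have Xc := X_neg Ow X0; move: X0; rewrite Xc => X0.
    rewrite max_l ?oppr_ge0 ?(ltW X0)//.
    have W0 : W w != 0 by rewrite gt_eqF// -ec ltr_wpDl// oppr_gt0.
    by rewrite mulr0 add0r -mulrDr ec -mulrA mulVf// mulr1.
  - by rewrite -X0 X_zero// oppr0 maxxx !mulr0 !addr0.
transitivity (\int[P]_w (A w + (q (W w) * pos w + p (W w) * neg w))%:E)%E.
  rewrite split3// split3// bal// -(bal p)//.
  by rewrite [X in (_ + X)%E]addeC bal// -(bal q).
apply: onO => //; [exact: mmid| |exact: mid_ge0| |].
- by apply: (measurableT_comp (measurable_two_point_mean mF)).
- by move=> w; exact: two_point_mean_ge0.
move=> w Ow; rewrite /A /pos /neg /p /q /s /two_point_mean.
have Vw := WV0 Ow; rewrite ehatE// chatE// gap_splitting_norm//.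
have ec := ecE Vw; have [c0 e0] := (c_le0 Vw, e_ge0 Vw).
have [X0|X0|X0] := ltgtP 0 (X w).
- have Xe := X_pos Ow X0; move: X0; rewrite Xe => X0.
  rewrite max_r ?oppr_le0 ?(ltW X0)//.
  have W0 : W w != 0 by rewrite gt_eqF// -ec ltr_wpDr// oppr_ge0.
  by rewrite W0 mulr0 addr0; ring.
- have Xc := X_neg Ow X0; move: X0; rewrite Xc => X0.
  rewrite max_l ?oppr_ge0 ?(ltW X0)// (ler0_norm c0).
  have W0 : W w != 0 by rewrite gt_eqF// -ec ltr_wpDl// oppr_gt0.
  by rewrite W0 mulr0 add0r; ring.
- by rewrite -X0 X_zero// eqxx oppr0 maxxx !mulr0 !addr0.
Qed.

(** Any two extensions agree on [V0], which contains W on [Omega0]. *)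
Lemma integral_gap_law (D : set R) (F : R * R -> R) (k : R -> \bar R) :
  measurable D -> V0 `<=` D -> measurable_fun setT F -> (forall z, 0 <= F z) ->
  (forall v, V0 v -> k v = (two_point_mean F v)%:E) ->
  is_integral_from (distribution P (gap X U)) V0 D k
    (\int[P]_w (F (X w, W w))%:E)%E.
Proof.
move=> mD V0D mF F0 kF; split.
  exists (fun v => (two_point_mean F v)%:E); split.
  - by apply/measurable_EFinP; exact: measurable_two_point_mean.
  - by move=> v; rewrite lee_fin two_point_mean_ge0.
  - by move=> v /kF.
move=> g [mg g0 gk].
have mgW : measurable_fun setT (fun w => g (W w)) by exact: (measurableT_comp mg).
have mD' : measurable (EFin @` D) by exact: measurable_image_EFin.
have mgf : measurable_fun setT (fun y : \bar R => g (fine y)).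
  exact: (measurableT_comp mg (fine_measurable measurableT)).
have := ge0_integral_pushforward (measurable_gap X U) P mD'.
move=> /(_ _ (measurable_funTS mgf)) -> //.
have mB : measurable (gap X U @^-1` (EFin @` D)).
  by rewrite -[X in measurable X]setTI; exact: measurable_gap.
have OB : Omega0 `<=` gap X U @^-1` (EFin @` D).
  by move=> w Ow; exists (W w); [exact/V0D/WV0|rewrite gapW].
have PB : P (gap X U @^-1` (EFin @` D)) = 1%E.
  apply/eqP; rewrite eq_le probability_le1//= -PO.
  by apply: le_measure; rewrite ?inE.
rewrite (integral_full_measure mB PB)//=.
rewrite -(integral_full_measure mO PO)// integral_two_point_mean//.
rewrite -[RHS](integral_full_measure mO PO)//.
- by apply: eq_integral => w /set_mem Ow; rewrite gk ?kF//; exact: WV0.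
- apply/measurable_EFinP; exact: (measurableT_comp (measurable_two_point_mean mF)).
- by move=> w; rewrite lee_fin two_point_mean_ge0.
Qed.

Lemma gap_splitting_neq v : V0 v -> v != 0 -> c v != e v.
Proof.
move=> Vv; apply: contra_neq => ce.
by rewrite -(ecE Vv) ce subrr.
Qed.

Lemma gap_splitting0 : V0 0 -> c 0 = 0 /\ e 0 = 0.
Proof.
move=> V00; have := ecE V00; have := c_le0 V00; have := e_ge0 V00.
by move=> e0 c0 ec; split; apply/eqP; rewrite eq_le ?e0 ?c0/=; lra.
Qed.

Section two_point_law.
Context (v : R) (d' : measure_display) (T' : measurableType d')
  (Pv : probability T' R) (D : {RV Pv >-> R}).
Hypothesis Vv : V0 v.
Hypothesis D_law : v != 0 ->
  distribution Pv D [set e v] = (`|c v| / (`|c v| + e v))%:E /\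
  distribution Pv D [set c v] = (e v / (`|c v| + e v))%:E.
Hypothesis D_zero : v = 0 -> forall w, D w = 0.

Let weight1 : v != 0 -> e v / (`|c v| + e v) + `|c v| / (`|c v| + e v) = 1.
Proof.
move=> v0; rewrite gap_splitting_norm// -mulrDl addrC.
by rewrite gap_splitting_norm// divff.
Qed.

Lemma expectation_two_point_law (f : R -> R) : measurable_fun setT f ->
  ('E_Pv[f \o D] = (if v != 0 then f (c v) * (e v / (`|c v| + e v)) +
                                   f (e v) * (`|c v| / (`|c v| + e v))
                    else f 0)%R%:E)%E.
Proof.
move=> mf; case: ifPn => [v0|/negPn/eqP v0].
  have [De Dc] := D_law v0.
  by apply: expectation_two_point => //; [exact: gap_splitting_neq|exact: weight1].
rewrite (_ : f \o D = cst (f 0)) ?expectation_cst//.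
by apply/funext => w /=; rewrite D_zero.
Qed.

Lemma two_point_law_support : distribution Pv D [set c v; e v] = 1%E.
Proof.
have [v0|v0] := eqVneq v 0.
  have [c0 e0] : c v = 0 /\ e v = 0 by rewrite v0; apply: gap_splitting0; rewrite -v0.
  rewrite c0 e0 setUid /distribution /pushforward.
  rewrite (_ : D @^-1` [set 0] = setT) ?probability_setT//.
  by apply/seteqP; split=> w //= _; exact: D_zero.
have [De Dc] := D_law v0.
rewrite measureU//; last first.
  apply/seteqP; split=> x //= [-> /eqP].
  by rewrite (negbTE (gap_splitting_neq Vv v0)).
by rewrite [X in (_ + X)%E]De [X in (X + _)%E]Dc -EFinD weight1.
Qed.

Lemma expectation_two_point_law0 : ('E_Pv[D] = 0)%E.
Proof.
rewrite -[X in ('E_Pv[X])%E]/(id \o D) expectation_two_point_law//.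
case: ifPn => // v0; rewrite ler0_norm ?c_le0//; congr EFin; ring.
Qed.

End two_point_law.

End disintegration.

(** * The disintegration theorem *)

Theorem theorem2p1 (d : measure_display) (T : measurableType d) (R : realType)
    (P : probability T R) (X U : {RV P >-> R}) :
  zero_mean X -> uniform01 U -> independent X U ->
  (exists (Omega0 : set T) (c e : R -> R), gap_splitting X U Omega0 c e) /\
  (forall (Omega0 : set T) (c e : R -> R), gap_splitting X U Omega0 c e ->
   forall (dD : R -> measure_display) (TD : forall v : R, measurableType (dD v))
     (PD : forall v : R, probability (TD v) R)
     (D : forall v : R, {RV (PD v) >-> R}),
   let W : {RV P >-> \bar R} := gap X U in
   let V0 := gap_values X U Omega0 in
   (forall v, V0 v -> v != 0 ->
      distribution (PD v) (D v) [set e v] = (`|c v| / (`|c v| + e v))%:E /\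
      distribution (PD v) (D v) [set c v] = (e v / (`|c v| + e v))%:E) ->
   (V0 0 -> forall w, D 0 w = 0) ->
   [/\ forall v, V0 v ->
         distribution (PD v) (D v) [set c v; e v] = 1%E /\
         ('E_(PD v)[D v] = 0)%E,
       forall f : R -> R, measurable_fun setT f -> (forall x, 0 <= f x) ->
         let phi v := ('E_(PD v)[f \o D v])%E in
         (forall v, V0 v -> phi v =
            (if v != 0 then f (c v) * (e v / (`|c v| + e v)) +
                            f (e v) * (`|c v| / (`|c v| + e v))
             else f 0)%:E) /\
         (forall B : set R, measurable B -> B `<=` [set v | 0 <= v] ->
            let EfX := ('E_P[(fun w => f (X w) * \1_(EFin @` B) (W w))%R])%E in
            let EfD v := ('E_(PD v)[(fun w => f (D v w) * \1_B v)%R])%E in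
            [/\ EfX = (\int[P]_(w in Omega0)
                         (phi (fine (W w)) * (\1_(EFin @` B) (W w))%:E))%E,
                is_integral_from (distribution P W) V0 setT EfD EfX &
                is_integral_from (distribution P W) V0 [set v | 0 <= v]
                  EfD EfX]) &
       forall F : R * R -> R, measurable_fun setT F -> (forall z, 0 <= F z) ->
         let EFX := ('E_P[(fun w => F (X w, fine (W w)))%R])%E in
         let EFD v := ('E_(PD v)[(fun w => F (D v w, v))%R])%E in
         is_integral_from (distribution P W) V0 setT EFD EFX /\
         is_integral_from (distribution P W) V0 [set v | 0 <= v] EFD EFX]).
Proof.
move=> X0 U01 XU; split; first exact: gap_splitting_exists.
move=> Omega0 c e S dD TD PD D W V0 D_law D_zero.
have mO : measurable Omega0 by case: S => -[].
have PO : P Omega0 = 1%E by case: S => -[].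
have gapO w : Omega0 w -> exists v, V0 v /\ W w = v%:E.
  move=> Ow; case: S => _ _ _ _ /(_ w Ow)[v [gw _ _]].
  by exists v; split=> //; exists w.
have V0_ge0 : V0 `<=` [set v | 0 <= v].
  move=> v Vv; rewrite /= -(gap_splitting_norm S Vv) addr_ge0//.
  by case: S => _ [_ +] _ _ _; apply.
have mge0 : measurable [set v : R | 0 <= v].
  by rewrite -set_itvcy; exact: measurable_itv.
have Dv0 v : V0 v -> v = 0 -> forall w, D v w = 0.
  by move=> + v0; rewrite v0; exact: D_zero.
have E2 v (f : R -> R) : V0 v -> measurable_fun setT f ->
    ('E_(PD v)[f \o D v] = (if v != 0 then f (c v) * (e v / (`|c v| + e v)) +
                                  f (e v) * (`|c v| / (`|c v| + e v))
                            else f 0)%R%:E)%E.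
  move=> Vv mf; apply: (expectation_two_point_law S) => //.
  - exact: D_law.
  - exact: Dv0.
have EF v (F : R * R -> R) : V0 v -> measurable_fun setT F ->
    ('E_(PD v)[(fun w => F (D v w, v))%R] =
      (two_point_mean X U Omega0 e F v)%:E)%E.
  move=> Vv mF; rewrite (two_point_meanE S)//.
  rewrite (E2 v (fun x => F (x, v)))//; last exact: measurable_fun_pair1.
  by congr EFin; case: eqVneq => // ->.
split.
- move=> v Vv; split.
    by apply: (two_point_law_support S Vv (D_law v Vv)); exact: Dv0.
  by apply: (expectation_two_point_law0 S Vv (D_law v Vv)); exact: Dv0.
- move=> f mf f0 phi; split; first by move=> v Vv; exact: E2.
  move=> B mB B0 EfX EfD.
  pose F (z : R * R) := f z.1 * \1_B z.2.
  have mF : measurable_fun setT F.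
    apply: measurable_funM; first exact: (measurableT_comp mf).
    exact: (measurableT_comp (measurable_indic mB)).
  have F0 z : 0 <= F z by rewrite mulr_ge0.
  have mW : measurable_fun setT W by exact: measurable_gap.
  have mWB : measurable (W @^-1` (EFin @` B)).
    by rewrite -[X in measurable X]setTI; apply: mW => //; exact: measurable_image_EFin.
  have mFW : measurable_fun setT (fun w => F (X w, fine (W w))).
    apply: (measurableT_comp mF); apply: measurable_fun_pair => //.
    exact: (measurableT_comp (fine_measurable measurableT)).
  have indW w : Omega0 w -> \1_(EFin @` B) (W w) = \1_B (fine (W w)) :> R.
    move=> /gapO[v [_ ->]]; rewrite !indicE; congr (nat_of_bool _)%:R.
    by apply/idP/idP => /set_mem => [[u Bu [<-]]|Bv]; apply/mem_set => //; exists v.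
  have EfXE : EfX = (\int[P]_w (F (X w, fine (W w)))%:E)%E.
    rewrite /EfX unlock -(integral_full_measure mO PO); first last.
    + by move=> w; rewrite lee_fin mulr_ge0.
    + apply/measurable_EFinP; apply: measurable_funM.
        exact: measurableT_comp.
      exact: (measurable_indic mWB).
    rewrite -[RHS](integral_full_measure mO PO); first last.
    + by move=> w; rewrite lee_fin.
    + exact/measurable_EFinP.
    by apply: eq_integral => w /set_mem Ow; rewrite indW.
  have EfDE v : V0 v -> EfD v = (two_point_mean X U Omega0 e F v)%:E.
    by move=> Vv; exact: EF.
  split.
  + rewrite EfXE (integral_two_point_mean X0 U01 XU S mF F0).
    rewrite -(integral_full_measure mO PO); first last.
    * by move=> w; rewrite lee_fin (two_point_mean_ge0 S F0).
    * apply/measurable_EFinP.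
      apply: (measurableT_comp (measurable_two_point_mean S mF)).
      exact: (measurableT_comp (fine_measurable measurableT)).
    apply: eq_integral => w /set_mem Ow; rewrite indW//.
    have [v [Vv Wv]] := gapO w Ow; have gv : gap X U w = v%:E by exact: Wv.
    have phiE := E2 v f Vv mf; rewrite -[LHS]/(phi v) in phiE.
    rewrite gv Wv /= phiE (two_point_meanE S)// -EFinM; congr EFin; rewrite /F /=.
    by case: eqVneq => [v0|_] /=; [rewrite v0|ring].
  + by rewrite EfXE; exact: (integral_gap_law X0 U01 XU S).
  + by rewrite EfXE; exact: (integral_gap_law X0 U01 XU S).
- move=> F mF F0 EFX EFD.
  have EFXE : EFX = (\int[P]_w (F (X w, fine (W w)))%:E)%E by rewrite /EFX unlock.
  rewrite EFXE; split; apply: (integral_gap_law X0 U01 XU S) => // v Vv.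
    exact: EF.
  exact: EF.
Qed.
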